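(* Let $K$ be a field, let $\mathcal O=\{\mathcal O(n)\}_{n\ge 0}$ be an operad in $Vect_K$ and let $\mathscr A$ and $\mathscr B$ be $\mathcal O$-algebras. Then there exists a $K$-coalgebra $\mathcal M=\mathcal M(\mathscr A,\mathscr B)$ and a measuring $\Phi:\mathcal M\longrightarrow \mathrm{Hom}_K(\mathscr A,\mathscr B)$ of $\mathcal O$-algebras with the following property: given any measuring $(C,\phi)$ from $\mathscr A$ to $\mathscr B$, there exists a unique morphism $\psi:C\longrightarrow\mathcal M$ of coalgebras such that $\Phi\circ\psi=\phi$. Further, taking the coalgebras $\mathcal M(\mathscr A,\mathscr B)$ to be the Hom-objects, the category of $\mathcal O$-algebras is enriched over the (monoidal) category of $K$-coalgebras.
   Context: An operad is a symmetric unital operad in the category $Vect_K$ of $K$-vector spaces: left $K[S_n]$-modules $\mathcal O(n)$ ($n\ge0$), compositions $\gamma:\mathcal O(n)\otimes\mathcal O(k_1)\otimes\cdots\otimes\mathcal O(k_n)\to\mathcal O(k_1+\cdots+k_n)$ ($n\geq 1$) and a unit $\eta:K\to\mathcal O(1)$ satisfying the usual associativity, equivariance and unitality axioms. An $\mathcal O$-algebra is a vector space $\mathscr A$ with maps $\alpha_{\mathscr A}(n):\mathcal O(n)\otimes\mathscr A^{\otimes n}\to\mathscr A$ ($n\ge 0$) satisfying the usual associativity, equivariance and unitality axioms; write $\theta(a_1\otimes\cdots\otimes a_n)=\alpha_{\mathscr A}(n)(\theta\otimes a_1\otimes\cdots\otimes a_n)$ and $u_{\mathscr A}=\alpha_{\mathscr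 A}(0):\mathcal O(0)\to\mathscr A$. Coalgebras $(C,\Delta,\epsilon)$ are coassociative and counital, with iterated coproduct $\Delta^{n-1}(c)=\sum c_1\otimes\cdots\otimes c_n$. A measuring $(C,\phi)$ of $\mathcal O$-algebras from $\mathscr A$ to $\mathscr B$ is a coalgebra $C$ and a linear map $\phi:C\to \mathrm{Hom}_K(\mathscr A,\mathscr B)$ such that $\phi(c)(\theta(a_1\otimes\cdots\otimes a_n))=\sum\theta(\phi(c_1)(a_1)\otimes\cdots\otimes\phi(c_n)(a_n))$ and $\phi(c)(u_{\mathscr A}(\theta_0))=\epsilon(c)u_{\mathscr B}(\theta_0)$ for all $c\in C$, $\theta\in\mathcal O(n)$, $n\ge 1$, $a_i\in\mathscr A$, $\theta_0\in\mathcal O(0)$. In the enrichment, the composition $\mathcal M(\mathscr A,\mathscr B)\otimes\mathcal M(\mathscr B,\mathscr E)\to\mathcal M(\mathscr A,\mathscr E)$ is the coalgebra morphism induced by the universal property from the measuring $x\otimes y\mapsto\Phi(y)\circ\Phi(x)$, and the unit $K\to\mathcal M(\mathscr A,\mathscr A)$ is induced by the measuring $t\mapsto t\cdot \mathrm{id}_{\mathscr A}$. *)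

(* Defs.v *)
From HB Require Import structures.
From mathcomp Require Import all_boot all_order all_fingroup all_algebra.
From mathcomp Require Import boolp.

Set Implicit Arguments.
Unset Strict Implicit.
Unset Printing Implicit Defensive.

Import GRing.Theory.
Local Open Scope ring_scope.
Local Open Scope quotient_scope.

Reserved Notation "V ⊗ W" (at level 40, left associativity).
Reserved Notation "v ⊗ₜ w" (at level 40, left associativity).

Section LinearMaps.
Variable K : fieldType.
Implicit Types U V W : lmodType K.

Lemma linear_eqP V W (f g : {linear V -> W}) : f =1 g -> f = g.
Proof.
case: f g => [f [[f1] [f2]]] [g [[g1] [g2]]] /= /funext fg; subst g.
by rewrite (Prop_irrelevance f1 g1) (Prop_irrelevance f2 g2).
Qed.

Definition mklin V W (f : V -> W) (hf : linear f) : {linear V -> W} :=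
  HB.pack f (GRing.isLinear.Build K V W *:%R f hf).

Definition linid V : {linear V -> V} := idfun.

Definition lincomp U V W (g : {linear V -> W}) (f : {linear U -> V}) :
  {linear U -> W} := g \o f.

End LinearMaps.

Section HomSpace.
Variables (K : fieldType) (V W : lmodType K).
Implicit Types f g : {linear V -> W}.

HB.instance Definition _ := gen_eqMixin {linear V -> W}.
HB.instance Definition _ := gen_choiceMixin {linear V -> W}.

Fact hom_zero_linear : linear (fun _ : V => 0 : W).
Proof. by move=> a u v; rewrite scaler0 addr0. Qed.
Fact hom_opp_linear f : linear (fun v => - f v).
Proof. by move=> a u v; rewrite linearP opprD scalerN. Qed.
Fact hom_add_linear f g : linear (fun v => f v + g v).
Proof. by move=> a u v; rewrite !linearP scalerDr addrACA. Qed.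
Fact hom_scale_linear a f : linear (fun v => a *: f v).
Proof. by move=> b u v; rewrite linearP scalerDr !scalerA mulrC. Qed.

Definition hom_zero := mklin hom_zero_linear.
Definition hom_opp f := mklin (hom_opp_linear f).
Definition hom_add f g := mklin (hom_add_linear f g).
Definition hom_scale a f := mklin (hom_scale_linear a f).

Fact hom_addA : associative hom_add.
Proof. by move=> f g h; apply: linear_eqP => v /=; rewrite addrA. Qed.
Fact hom_addC : commutative hom_add.
Proof. by move=> f g; apply: linear_eqP => v /=; rewrite addrC. Qed.
Fact hom_add0 : left_id hom_zero hom_add.
Proof. by move=> f; apply: linear_eqP => v /=; rewrite add0r. Qed.
Fact hom_addN : left_inverse hom_zero hom_opp hom_add.
Proof. by move=> f; apply: linear_eqP => v /=; rewrite addNr. Qed.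

HB.instance Definition _ := GRing.isZmodule.Build {linear V -> W}
  hom_addA hom_addC hom_add0 hom_addN.

Fact hom_scaleA a b f : hom_scale a (hom_scale b f) = hom_scale (a * b) f.
Proof. by apply: linear_eqP => v /=; rewrite scalerA. Qed.
Fact hom_scale1 : left_id 1 hom_scale.
Proof. by move=> f; apply: linear_eqP => v /=; rewrite scale1r. Qed.
Fact hom_scaleDr : right_distributive hom_scale +%R.
Proof. by move=> a f g; apply: linear_eqP => v /=; rewrite scalerDr. Qed.
Fact hom_scaleDl f : {morph hom_scale^~ f : a b / a + b}.
Proof. by move=> a b; apply: linear_eqP => v /=; rewrite scalerDl. Qed.

HB.instance Definition _ := GRing.Zmodule_isLmodule.Build K {linear V -> W}
  hom_scaleA hom_scale1 hom_scaleDr hom_scaleDl.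

Definition homK : lmodType K := {linear V -> W}.

Fact hom_eval_linear v : linear (fun f : homK => (f : {linear V -> W}) v).
Proof. by []. Qed.
Definition hom_eval v : {linear homK -> W} := mklin (hom_eval_linear v).

End HomSpace.

Arguments hom_eval {K V W} v.

(* A formal sum [:: (v1, w1); ...; (vr, wr)] represents v1 ⊗ w1 + ... + vr ⊗ wr;
   two formal sums are identified when no bilinear map separates them.  The
   universal property is [tens_lift], [tens_liftE] and [tens_ext] below. *)

Notation is_bilinear f := (bilinear_for *:%R *:%R f).

Section Tensor.
Variables (K : fieldType) (V W : lmodType K).
Implicit Types s t : seq (V * W).

Definition tens_sum (P : lmodType K) (f : V -> W -> P) s : P :=
  \sum_(x <- s) f x.1 x.2.

Definition tens_eq s t : bool :=
  `[< forall (P : lmodType K) (f : V -> W -> P),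
        is_bilinear f -> tens_sum f s = tens_sum f t >].

Fact tens_eq_refl : reflexive tens_eq.
Proof. by move=> s; apply/asboolP. Qed.
Fact tens_eq_sym : symmetric tens_eq.
Proof. by move=> s t; apply/asboolP/asboolP => h P f hf; rewrite h. Qed.
Fact tens_eq_trans : transitive tens_eq.
Proof.
by move=> t s u /asboolP st /asboolP tu; apply/asboolP => P f hf; rewrite st ?tu.
Qed.

Canonical tens_equiv := EquivRel tens_eq tens_eq_refl tens_eq_sym tens_eq_trans.
Definition tens_space := {eq_quot tens_equiv}.
HB.instance Definition _ := Choice.on tens_space.

Definition tens_cls s : tens_space := \pi_{eq_quot tens_equiv} s.

Fact tens_clsP s t : tens_cls s = tens_cls t <->
  forall (P : lmodType K) (f : V -> W -> P),
    is_bilinear f -> tens_sum f s = tens_sum f t.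
Proof. by split => [/eqmodP /asboolP | h]; last by apply/eqmodP/asboolP. Qed.

Definition tens_rep (x : tens_space) : seq (V * W) := generic_quotient.repr x.

Fact tens_repK : cancel tens_rep tens_cls.
Proof. by move=> x; rewrite /tens_cls /tens_rep reprK. Qed.

Definition seq_scale (a : K) s := [seq (a *: x.1, x.2) | x <- s].

Section Sums.
Variables (P : lmodType K) (f : V -> W -> P).
Hypothesis hf : is_bilinear f.

Let fl w : {linear V -> P} := mklin (hf.1 w).
Let fr v : {linear W -> P} := mklin (hf.2 v).

Fact bilin_l0 w : f 0 w = 0. Proof. exact: (linear0 (fl w)). Qed.
Fact bilin_lZ a v w : f (a *: v) w = a *: f v w.
Proof. exact: (linearZ_LR (fl w)). Qed.
Fact bilin_lD v v' w : f (v + v') w = f v w + f v' w.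
Proof. exact: (linearD (fl w)). Qed.
Fact bilin_r0 v : f v 0 = 0. Proof. exact: (linear0 (fr v)). Qed.
Fact bilin_rZ a v w : f v (a *: w) = a *: f v w.
Proof. exact: (linearZ_LR (fr v)). Qed.
Fact bilin_rD v w w' : f v (w + w') = f v w + f v w'.
Proof. exact: (linearD (fr v)). Qed.

Fact tens_sum_cat s t : tens_sum f (s ++ t) = tens_sum f s + tens_sum f t.
Proof. exact: big_cat. Qed.
Fact tens_sum_scale a s : tens_sum f (seq_scale a s) = a *: tens_sum f s.
Proof.
by rewrite /tens_sum big_map scaler_sumr; apply: eq_bigr => x _; rewrite bilin_lZ.
Qed.
End Sums.

Fact tens_sum_rep s (P : lmodType K) (f : V -> W -> P) :
  is_bilinear f -> tens_sum f (tens_rep (tens_cls s)) = tens_sum f s.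
Proof. by move: P f; apply/tens_clsP; rewrite tens_repK. Qed.

Definition tens_zero := tens_cls [::].
Definition tens_add x y := tens_cls (tens_rep x ++ tens_rep y).
Definition tens_scale a x := tens_cls (seq_scale a (tens_rep x)).
Definition tens_opp x := tens_scale (-1) x.

Fact tens_addA : associative tens_add.
Proof.
by move=> x y z; apply/tens_clsP => P f hf; rewrite !tens_sum_cat !tens_sum_rep //
   !tens_sum_cat addrA.
Qed.
Fact tens_addC : commutative tens_add.
Proof. by move=> x y; apply/tens_clsP => P f hf; rewrite !tens_sum_cat addrC. Qed.
Fact tens_add0 : left_id tens_zero tens_add.
Proof.
move=> x; rewrite -[RHS]tens_repK; apply/tens_clsP => P f hf.
by rewrite tens_sum_cat tens_sum_rep // /tens_sum big_nil add0r.
Qed.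
Fact tens_addN : left_inverse tens_zero tens_opp tens_add.
Proof.
move=> x; apply/tens_clsP => P f hf.
rewrite tens_sum_cat tens_sum_rep // tens_sum_scale // scaleN1r addNr.
by rewrite /tens_sum big_nil.
Qed.

HB.instance Definition _ :=
  GRing.isZmodule.Build tens_space tens_addA tens_addC tens_add0 tens_addN.

Fact tens_scaleA a b x : tens_scale a (tens_scale b x) = tens_scale (a * b) x.
Proof.
apply/tens_clsP => P f hf.
by rewrite !tens_sum_scale // tens_sum_rep // tens_sum_scale // scalerA.
Qed.
Fact tens_scale1 : left_id 1 tens_scale.
Proof.
move=> x; rewrite -[RHS]tens_repK; apply/tens_clsP => P f hf.
by rewrite tens_sum_scale // scale1r.
Qed.
Fact tens_scaleDr : right_distributive tens_scale +%R.
Proof.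
move=> a x y; apply/tens_clsP => P f hf.
rewrite tens_sum_scale // tens_sum_rep // !tens_sum_cat.
by rewrite !tens_sum_rep // !tens_sum_scale // scalerDr.
Qed.
Fact tens_scaleDl x : {morph tens_scale^~ x : a b / a + b}.
Proof.
move=> a b; apply/tens_clsP => P f hf.
by rewrite tens_sum_scale // tens_sum_cat !tens_sum_rep // !tens_sum_scale // scalerDl.
Qed.

HB.instance Definition _ := GRing.Zmodule_isLmodule.Build K tens_space
  tens_scaleA tens_scale1 tens_scaleDr tens_scaleDl.

Definition tensor : lmodType K := tens_space.

Definition pure (v : V) (w : W) : tensor := tens_cls [:: (v, w)].

Lemma pure_bilinear : is_bilinear pure.
Proof.
split=> [w|v] a x y; apply/tens_clsP => P f hf;
  rewrite tens_sum_cat !tens_sum_rep // tens_sum_scale // tens_sum_rep //;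
  by rewrite /tens_sum !big_seq1 /= ?bilin_lD ?bilin_lZ ?bilin_rD ?bilin_rZ.
Qed.

Fact tens_rep_sum x : x = \sum_(p <- tens_rep x) pure p.1 p.2.
Proof.
rewrite -{1}[x]tens_repK; elim: (tens_rep x) => [|[v w] s IH]; rewrite ?big_nil // big_cons -IH.
by apply/tens_clsP => P f hf; rewrite tens_sum_cat !tens_sum_rep // -tens_sum_cat.
Qed.

Lemma tens_ind (Q : tensor -> Prop) :
  Q 0 -> (forall v w, Q (pure v w)) -> (forall x y, Q x -> Q y -> Q (x + y)) ->
  forall x, Q x.
Proof.
by move=> Q0 Qp QD x; rewrite (tens_rep_sum x); apply: big_ind.
Qed.

Lemma tens_ext (P : lmodType K) (f g : {linear tensor -> P}) :
  (forall v w, f (pure v w) = g (pure v w)) -> f = g.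
Proof.
move=> fg; apply: linear_eqP; elim/tens_ind => //; first by rewrite !linear0.
by move=> x y hx hy; rewrite !linearD hx hy.
Qed.

Section Lift.
Variables (P : lmodType K) (f : V -> W -> P).
Hypothesis hf : is_bilinear f.

Fact tens_lift_linear : linear (fun x : tensor => tens_sum f (tens_rep x)).
Proof.
move=> a x y; rewrite tens_sum_rep // tens_sum_cat tens_sum_rep //.
by rewrite tens_sum_scale.
Qed.

Definition tens_lift : {linear tensor -> P} := locked (mklin tens_lift_linear).

Lemma tens_liftE v w : tens_lift (pure v w) = f v w.
Proof. by rewrite /tens_lift -lock /= tens_sum_rep // /tens_sum big_seq1. Qed.

End Lift.

End Tensor.

Arguments pure {K V W} v w.
Arguments pure : simpl never.
Notation "V ⊗ W" := (tensor V W) : type_scope.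
Notation "v ⊗ₜ w" := (pure v w) : ring_scope.

Section TensorMaps.
Variable K : fieldType.
Implicit Types U V W X Y Z : lmodType K.

Fact pureDl V W (v v' : V) (w : W) : (v + v') ⊗ₜ w = v ⊗ₜ w + v' ⊗ₜ w.
Proof. exact: (bilin_lD (pure_bilinear V W)). Qed.
Fact pureDr V W (v : V) (w w' : W) : v ⊗ₜ (w + w') = v ⊗ₜ w + v ⊗ₜ w'.
Proof. exact: (bilin_rD (pure_bilinear V W)). Qed.
Fact pureZl V W a (v : V) (w : W) : (a *: v) ⊗ₜ w = a *: (v ⊗ₜ w).
Proof. exact: (bilin_lZ (pure_bilinear V W)). Qed.
Fact pureZr V W a (v : V) (w : W) : v ⊗ₜ (a *: w) = a *: (v ⊗ₜ w).
Proof. exact: (bilin_rZ (pure_bilinear V W)). Qed.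
Fact pure0l V W (w : W) : (0 : V) ⊗ₜ w = 0.
Proof. exact: (bilin_l0 (pure_bilinear V W)). Qed.
Fact pure0r V W (v : V) : v ⊗ₜ (0 : W) = 0.
Proof. exact: (bilin_r0 (pure_bilinear V W)). Qed.

Section Uncurry.
Variables (X Y Z : lmodType K) (F : {linear X -> homK Y Z}).
Fact uncurry_bilinear : is_bilinear (fun x y => (F x : {linear Y -> Z}) y).
Proof. by split=> [y|x] a u v; rewrite linearP. Qed.
Definition tens_uncurry : {linear X ⊗ Y -> Z} := tens_lift uncurry_bilinear.
Lemma tens_uncurryE x y : tens_uncurry (x ⊗ₜ y) = (F x : {linear Y -> Z}) y.
Proof. exact: tens_liftE. Qed.
End Uncurry.

Section Map.
Variables (V V' W W' : lmodType K) (f : {linear V -> V'}) (g : {linear W -> W'}).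
Fact tmap_bilinear : is_bilinear (fun v w => f v ⊗ₜ g w).
Proof.
by split=> [w|v] a x y; rewrite linearP ?(pureDl, pureDr) ?(pureZl, pureZr).
Qed.
Definition tmap : {linear V ⊗ W -> V' ⊗ W'} := tens_lift tmap_bilinear.
Lemma tmapE v w : tmap (v ⊗ₜ w) = f v ⊗ₜ g w.
Proof. exact: tens_liftE. Qed.
End Map.

Section Assoc.
Variables U V W : lmodType K.

Fact tassoc1_linear u v : linear (fun w : W => (u : U) ⊗ₜ ((v : V) ⊗ₜ w)).
Proof. by move=> a x y; rewrite !(pureDr, pureZr). Qed.
Fact tassoc_bilinear :
  is_bilinear (fun u v => mklin (tassoc1_linear u v) : homK W (U ⊗ (V ⊗ W))).
Proof.
by split=> [v|u] a x y; apply: linear_eqP => w /=; rewrite ?(pureDl, pureZl)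
  ?(pureDr, pureZr).
Qed.
Definition tassoc : {linear (U ⊗ V) ⊗ W -> U ⊗ (V ⊗ W)} :=
  tens_uncurry (tens_lift tassoc_bilinear).
Lemma tassocE u v w : tassoc ((u ⊗ₜ v) ⊗ₜ w) = u ⊗ₜ (v ⊗ₜ w).
Proof. by rewrite tens_uncurryE tens_liftE. Qed.

Fact tassocV1_bilinear u : is_bilinear (fun (v : V) (w : W) => ((u : U) ⊗ₜ v) ⊗ₜ w).
Proof.
by split=> [w|v] a x y; rewrite ?(pureDr, pureZr) ?(pureDl, pureZl).
Qed.
Fact tassocV_linear :
  linear (fun u : U => tens_lift (tassocV1_bilinear u) : homK (V ⊗ W) ((U ⊗ V) ⊗ W)).
Proof.
move=> a x y; apply: (@tens_ext _ V W ((U ⊗ V) ⊗ W)) => v w.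
by rewrite /= !tens_liftE !(pureDl, pureZl).
Qed.
Definition tassocV : {linear U ⊗ (V ⊗ W) -> (U ⊗ V) ⊗ W} :=
  tens_uncurry (mklin tassocV_linear).
Lemma tassocVE u v w : tassocV (u ⊗ₜ (v ⊗ₜ w)) = (u ⊗ₜ v) ⊗ₜ w.
Proof. by rewrite tens_uncurryE tens_liftE. Qed.
End Assoc.

Section Unitors.
Variable V : lmodType K.
Fact tlunit_bilinear : is_bilinear (fun (a : K^o) (v : V) => (a : K) *: v).
Proof.
split=> [v|b] a x y; first by rewrite scalerDl -scalerA.
by rewrite scalerDr scalerA mulrC -scalerA.
Qed.
Definition tlunit : {linear K^o ⊗ V -> V} := tens_lift tlunit_bilinear.
Lemma tlunitE a v : tlunit (a ⊗ₜ v) = (a : K) *: v.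
Proof. exact: tens_liftE. Qed.

Fact trunit_bilinear : is_bilinear (fun (v : V) (a : K^o) => (a : K) *: v).
Proof.
split=> [b|v] a x y; last by rewrite scalerDl -scalerA.
by rewrite scalerDr scalerA mulrC -scalerA.
Qed.
Definition trunit : {linear V ⊗ K^o -> V} := tens_lift trunit_bilinear.
Lemma trunitE a v : trunit (v ⊗ₜ a) = (a : K) *: v.
Proof. exact: tens_liftE. Qed.

Fact tlunitV_linear : linear (fun v : V => (1 : K^o) ⊗ₜ v).
Proof. by move=> a x y; rewrite pureDr pureZr. Qed.
Definition tlunitV : {linear V -> K^o ⊗ V} := mklin tlunitV_linear.

Fact trunitV_linear : linear (fun v : V => v ⊗ₜ (1 : K^o)).
Proof. by move=> a x y; rewrite pureDl pureZl. Qed.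
Definition trunitV : {linear V -> V ⊗ K^o} := mklin trunitV_linear.
End Unitors.

Section Interchange.
Variables A B C D : lmodType K.

Fact tswap1_bilinear a b :
  is_bilinear (fun c d => ((a : A) ⊗ₜ (c : C)) ⊗ₜ ((b : B) ⊗ₜ (d : D))).
Proof.
by split=> [u|u] k x y; rewrite ?(pureDr, pureZr) ?(pureDl, pureZl) ?(pureDr, pureZr).
Qed.
Fact tswap_bilinear :
  is_bilinear (fun a b => tens_lift (tswap1_bilinear a b) : homK (C ⊗ D) ((A ⊗ C) ⊗ (B ⊗ D))).
Proof.
by split=> [u|u] k x y; 
  apply: (@tens_ext _ C D ((A ⊗ C) ⊗ (B ⊗ D))) => c d;
  rewrite /= !tens_liftE
    ?(pureDr, pureZr) ?(pureDl, pureZl) ?(pureDr, pureZr).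
Qed.
Definition tswap : {linear (A ⊗ B) ⊗ (C ⊗ D) -> (A ⊗ C) ⊗ (B ⊗ D)} :=
  tens_uncurry (tens_lift tswap_bilinear).
Lemma tswapE a b c d :
  tswap ((a ⊗ₜ b) ⊗ₜ (c ⊗ₜ d)) = (a ⊗ₜ c) ⊗ₜ (b ⊗ₜ d).
Proof. by rewrite tens_uncurryE tens_liftE tens_liftE. Qed.
End Interchange.

End TensorMaps.

Section TensorFamilies.
Variable K : fieldType.

Fixpoint tensn n : ('I_n -> lmodType K) -> lmodType K :=
  match n with
  | 0 => fun _ => K^o
  | n'.+1 => fun V => V ord0 ⊗ tensn (fun i => V (lift ord0 i))
  end.

Fixpoint puren n : forall V : 'I_n -> lmodType K, (forall i, V i) -> tensn V :=
  match n with
  | 0 => fun _ _ => (1 : K^o)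
  | n'.+1 => fun V v => v ord0 ⊗ₜ puren (fun i => v (lift ord0 i))
  end.

Fixpoint tmapn n : forall V W : 'I_n -> lmodType K,
    (forall i, {linear V i -> W i}) -> {linear tensn V -> tensn W} :=
  match n with
  | 0 => fun _ _ _ => linid _
  | n'.+1 => fun V W f => tmap (f ord0) (tmapn (fun i => f (lift ord0 i)))
  end.

Lemma tmapnE n (V W : 'I_n -> lmodType K) (f : forall i, {linear V i -> W i})
    (v : forall i, V i) :
  tmapn f (puren v) = puren (fun i => f i (v i)).
Proof.
elim: n V W f v => [|n IH] V W f v //; rewrite [LHS]tmapE.
by congr (_ ⊗ₜ _); apply: IH.
Qed.

End TensorFamilies.

Record category := Category {
  cat_ob :> Type;
  cat_hom : cat_ob -> cat_ob -> Type;
  cat_id : forall x, cat_hom x x;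
  (* composition in diagrammatic order *)
  cat_comp : forall x y z, cat_hom x y -> cat_hom y z -> cat_hom x z;
  cat_comp1m : forall x y (f : cat_hom x y), cat_comp (cat_id x) f = f;
  cat_compm1 : forall x y (f : cat_hom x y), cat_comp f (cat_id y) = f;
  cat_compA : forall x y z t (f : cat_hom x y) (g : cat_hom y z) (h : cat_hom z t),
    cat_comp f (cat_comp g h) = cat_comp (cat_comp f g) h }.

Arguments cat_id {c} x.
Arguments cat_comp {c x y z} f g.
Reserved Notation "f ;; g" (at level 50, left associativity).
Notation "f ;; g" := (cat_comp f g).

Record monoidal := Monoidal {
  mon_cat :> category;
  mon_unit : mon_cat;
  mon_tens : mon_cat -> mon_cat -> mon_cat;
  mon_map : forall x x' y y', cat_hom x x' -> cat_hom y y' ->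
    cat_hom (mon_tens x y) (mon_tens x' y');
  mon_assoc : forall x y z,
    cat_hom (mon_tens (mon_tens x y) z) (mon_tens x (mon_tens y z));
  mon_assocV : forall x y z,
    cat_hom (mon_tens x (mon_tens y z)) (mon_tens (mon_tens x y) z);
  mon_lunit : forall x, cat_hom (mon_tens mon_unit x) x;
  mon_lunitV : forall x, cat_hom x (mon_tens mon_unit x);
  mon_runit : forall x, cat_hom (mon_tens x mon_unit) x;
  mon_runitV : forall x, cat_hom x (mon_tens x mon_unit);
  mon_map1 : forall x y, mon_map (cat_id x) (cat_id y) = cat_id (mon_tens x y);
  mon_mapM : forall x x' x'' y y' y''
    (f : cat_hom x x') (f' : cat_hom x' x'') (g : cat_hom y y') (g' : cat_hom y' y''),
    mon_map (f ;; f') (g ;; g') = mon_map f g ;; mon_map f' g';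
  mon_assocK : forall x y z, mon_assoc x y z ;; mon_assocV x y z = cat_id _;
  mon_assocVK : forall x y z, mon_assocV x y z ;; mon_assoc x y z = cat_id _;
  mon_lunitK : forall x, mon_lunit x ;; mon_lunitV x = cat_id _;
  mon_lunitVK : forall x, mon_lunitV x ;; mon_lunit x = cat_id _;
  mon_runitK : forall x, mon_runit x ;; mon_runitV x = cat_id _;
  mon_runitVK : forall x, mon_runitV x ;; mon_runit x = cat_id _;
  mon_assoc_nat : forall x x' y y' z z'
    (f : cat_hom x x') (g : cat_hom y y') (h : cat_hom z z'),
    mon_map (mon_map f g) h ;; mon_assoc x' y' z'
    = mon_assoc x y z ;; mon_map f (mon_map g h);
  mon_lunit_nat : forall x x' (f : cat_hom x x'),
    mon_map (cat_id mon_unit) f ;; mon_lunit x' = mon_lunit x ;; f;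
  mon_runit_nat : forall x x' (f : cat_hom x x'),
    mon_map f (cat_id mon_unit) ;; mon_runit x' = mon_runit x ;; f;
  mon_pentagon : forall x y z t,
    mon_assoc (mon_tens x y) z t ;; mon_assoc x y (mon_tens z t)
    = mon_map (mon_assoc x y z) (cat_id t) ;; mon_assoc x (mon_tens y z) t ;;
      mon_map (cat_id x) (mon_assoc y z t);
  mon_triangle : forall x y,
    mon_assoc x mon_unit y ;; mon_map (cat_id x) (mon_lunit y)
    = mon_map (mon_runit x) (cat_id y) }.

Arguments mon_map {m x x' y y'} f g.

(* A category enriched over V with the objects of C and the given Hom-objects,
   together with an identification of its underlying ordinary category with C. *)
Record enrichment (V : monoidal) (C : category) (H : C -> C -> V) := Enrichment {
  enr_comp : forall x y z, cat_hom (mon_tens (H x y) (H y z)) (H x z);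
  enr_unit : forall x, cat_hom (mon_unit V) (H x x);
  enr_assoc : forall x y z t,
    mon_map (enr_comp x y z) (cat_id (H z t)) ;; enr_comp x z t
    = mon_assoc (H x y) (H y z) (H z t) ;;
      mon_map (cat_id (H x y)) (enr_comp y z t) ;; enr_comp x y t;
  enr_unitl : forall x y,
    mon_map (enr_unit x) (cat_id (H x y)) ;; enr_comp x x y = mon_lunit (H x y);
  enr_unitr : forall x y,
    mon_map (cat_id (H x y)) (enr_unit y) ;; enr_comp x y y = mon_runit (H x y);
  enr_hom : forall x y, cat_hom x y -> cat_hom (mon_unit V) (H x y);
  enr_hom_bij : forall x y, bijective (@enr_hom x y);
  enr_hom1 : forall x, enr_hom (cat_id x) = enr_unit x;
  enr_homM : forall x y z (f : cat_hom x y) (g : cat_hom y z),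
    enr_hom (f ;; g)
    = mon_lunitV (mon_unit V) ;; mon_map (enr_hom f) (enr_hom g) ;; enr_comp x y z }.

Record coalgebra (K : fieldType) := Coalgebra {
  coalg_space :> lmodType K;
  coprod : {linear coalg_space -> coalg_space ⊗ coalg_space};
  counit : {linear coalg_space -> K^o};
  coprodA : forall c, tassoc _ _ _ (tmap coprod (linid _) (coprod c))
                      = tmap (linid _) coprod (coprod c);
  counitl : forall c, tmap counit (linid _) (coprod c) = (1 : K^o) ⊗ₜ c;
  counitr : forall c, tmap (linid _) counit (coprod c) = c ⊗ₜ (1 : K^o) }.

Record coalg_hom (K : fieldType) (C D : coalgebra K) := CoalgHom {
  coalg_map :> {linear C -> D};
  coalg_map_coprod : forall c,
    coprod D (coalg_map c) = tmap coalg_map coalg_map (coprod C c);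
  coalg_map_counit : forall c, counit D (coalg_map c) = counit C c }.

Lemma coalg_hom_eq (K : fieldType) (C D : coalgebra K) (f g : coalg_hom C D) :
  (forall c, f c = g c) -> f = g.
Proof.
case: f g => [f f1 f2] [g g1 g2] /= /linear_eqP fg; subst g.
by rewrite (Prop_irrelevance f1 g1) (Prop_irrelevance f2 g2).
Qed.

Tactic Notation "tens_induct" ident(x) "as" ident(p) ident(q) :=
  let IH1 := fresh in let IH2 := fresh in
  elim/tens_ind: x => [|p q|? ? IH1 IH2];
  [ by rewrite ?(pure0l, pure0r, linear0)
  | | by rewrite ?(pureDl, pureDr, linearD); congr (_ + _); [apply: IH1 | apply: IH2] ].

Tactic Notation "tens_induct" ident(x) :=
  let p := fresh in let q := fresh in tens_induct x as p q.

Section CoalgebraMonoidal.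
Variable K : fieldType.
Implicit Types C D E : coalgebra K.

Lemma tmap_id (V W : lmodType K) (x : V ⊗ W) : tmap (linid V) (linid W) x = x.
Proof. by tens_induct x; rewrite tmapE. Qed.

Lemma tmap_comp (V V' V'' W W' W'' : lmodType K)
    (f : {linear V -> V'}) (f' : {linear V' -> V''})
    (g : {linear W -> W'}) (g' : {linear W' -> W''}) x :
  tmap (lincomp f' f) (lincomp g' g) x = tmap f' g' (tmap f g x).
Proof. by tens_induct x; rewrite !tmapE. Qed.

Lemma tswap_nat (A A' B B' C C' D D' : lmodType K)
    (f : {linear A -> A'}) (g : {linear B -> B'})
    (h : {linear C -> C'}) (k : {linear D -> D'}) x y :
  tswap _ _ _ _ (tmap f g x ⊗ₜ tmap h k y)
  = tmap (tmap f h) (tmap g k) (tswap _ _ _ _ (x ⊗ₜ y)).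
Proof. by tens_induct x; tens_induct y; rewrite !(tmapE, tswapE). Qed.

Section CoalgTensor.
Variables C D : coalgebra K.

Definition ctens_coprod : {linear C ⊗ D -> (C ⊗ D) ⊗ (C ⊗ D)} :=
  lincomp (tswap _ _ _ _) (tmap (coprod C) (coprod D)).

Definition ctens_counit : {linear C ⊗ D -> K^o} :=
  lincomp (tlunit _) (tmap (counit C) (counit D)).

Lemma ctens_coprodE c d :
  ctens_coprod (c ⊗ₜ d) = tswap _ _ _ _ (coprod C c ⊗ₜ coprod D d).
Proof. by rewrite /= tmapE. Qed.

Lemma ctens_counitE c d :
  ctens_counit (c ⊗ₜ d) = (counit C c : K) *: counit D d.
Proof. by rewrite /= tmapE tlunitE. Qed.

Fact ctens_coprodA x :
  tassoc _ _ _ (tmap ctens_coprod (linid _) (ctens_coprod x))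
  = tmap (linid _) ctens_coprod (ctens_coprod x).
Proof.
pose big (p : C ⊗ (C ⊗ C)) (q : D ⊗ (D ⊗ D)) :=
  tmap (linid _) (tswap _ _ _ _) (tswap _ _ _ _ (p ⊗ₜ q)).
have L p q : tassoc _ _ _ (tmap ctens_coprod (linid _) (tswap _ _ _ _ (p ⊗ₜ q)))
  = big (tassoc _ _ _ (tmap (coprod C) (linid _) p))
        (tassoc _ _ _ (tmap (coprod D) (linid _) q)).
  rewrite /big; tens_induct p; tens_induct q.
  rewrite tswapE !tmapE ctens_coprodE /=.
  move: (coprod C _) (coprod D _) => x1 y1.
  by tens_induct x1; tens_induct y1; rewrite !(tswapE, tassocE, tmapE).
have R p q : tmap (linid _) ctens_coprod (tswap _ _ _ _ (p ⊗ₜ q))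
  = big (tmap (linid _) (coprod C) p) (tmap (linid _) (coprod D) q).
  rewrite /big; tens_induct p; tens_induct q.
  by rewrite tswapE !tmapE ctens_coprodE /= tswapE tmapE.
tens_induct x; rewrite !ctens_coprodE L R.
by rewrite !coprodA.
Qed.

Fact ctens_counitl x : tmap ctens_counit (linid _) (ctens_coprod x) = (1 : K^o) ⊗ₜ x.
Proof.
have L p q : tmap ctens_counit (linid _) (tswap _ _ _ _ (p ⊗ₜ q))
  = tmap (tlunit _) (linid _) (tswap _ _ _ _
      (tmap (counit C) (linid _) p ⊗ₜ tmap (counit D) (linid _) q)).
  tens_induct p; tens_induct q.
  by rewrite tswapE !tmapE ctens_counitE tswapE tmapE tlunitE.
tens_induct x; rewrite ctens_coprodE L !counitl tswapE tmapE tlunitE.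
by rewrite scale1r.
Qed.

Fact ctens_counitr x : tmap (linid _) ctens_counit (ctens_coprod x) = x ⊗ₜ (1 : K^o).
Proof.
have L p q : tmap (linid _) ctens_counit (tswap _ _ _ _ (p ⊗ₜ q))
  = tmap (linid _) (tlunit _) (tswap _ _ _ _
      (tmap (linid _) (counit C) p ⊗ₜ tmap (linid _) (counit D) q)).
  tens_induct p; tens_induct q.
  by rewrite tswapE !tmapE ctens_counitE tswapE tmapE tlunitE.
tens_induct x; rewrite ctens_coprodE L !counitr tswapE tmapE tlunitE.
by rewrite scale1r.
Qed.

Definition coalg_tens : coalgebra K :=
  Coalgebra ctens_coprodA ctens_counitl ctens_counitr.

End CoalgTensor.

Fact cunit_coprodA (a : K^o) :
  tassoc _ _ _ (tmap (tlunitV K^o) (linid _) (tlunitV K^o a))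
  = tmap (linid _) (tlunitV K^o) (tlunitV K^o a).
Proof. by rewrite /= !tmapE tassocE. Qed.
Fact cunit_counitl (a : K^o) :
  tmap (linid K^o) (linid K^o) (tlunitV K^o a) = (1 : K^o) ⊗ₜ a.
Proof. by rewrite tmap_id. Qed.
Fact cunit_counitr (a : K^o) :
  tmap (linid K^o) (linid K^o) (tlunitV K^o a) = a ⊗ₜ (1 : K^o).
Proof.
rewrite tmap_id /= -[a in LHS]mulr1 -[X in _ ⊗ₜ X]/(a *: (1 : K^o)).
by rewrite pureZr -pureZl; congr (_ ⊗ₜ _); apply: mulr1.
Qed.

Definition coalg_unit : coalgebra K :=
  Coalgebra cunit_coprodA cunit_counitl cunit_counitr.

Fact coalg_id_coprod C c :
  coprod C (linid C c) = tmap (linid C) (linid C) (coprod C c).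
Proof. by rewrite tmap_id. Qed.
Definition coalg_id C : coalg_hom C C :=
  CoalgHom (@coalg_id_coprod C) (fun=> erefl).

Section Comp.
Variables (C D E : coalgebra K) (f : coalg_hom C D) (g : coalg_hom D E).
Fact coalg_comp_coprod c :
  coprod E (lincomp g f c) = tmap (lincomp g f) (lincomp g f) (coprod C c).
Proof. by rewrite tmap_comp /= !coalg_map_coprod. Qed.
Fact coalg_comp_counit c : counit E (lincomp g f c) = counit C c.
Proof. by rewrite /= !coalg_map_counit. Qed.
Definition coalg_comp : coalg_hom C E :=
  CoalgHom coalg_comp_coprod coalg_comp_counit.
End Comp.

Section TensMap.
Variables (C C' D D' : coalgebra K) (f : coalg_hom C C') (g : coalg_hom D D').
Fact coalg_tmap_coprod x :
  coprod (coalg_tens C' D') (tmap f g x)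
  = tmap (tmap f g) (tmap f g) (coprod (coalg_tens C D) x).
Proof.
rewrite /=; tens_induct x; rewrite !tmapE !coalg_map_coprod.
exact: tswap_nat.
Qed.
Fact coalg_tmap_counit x :
  counit (coalg_tens C' D') (tmap f g x) = counit (coalg_tens C D) x.
Proof. by rewrite /=; tens_induct x; rewrite !tmapE !coalg_map_counit. Qed.
Definition coalg_tmap : coalg_hom (coalg_tens C D) (coalg_tens C' D') :=
  @CoalgHom K (coalg_tens C D) (coalg_tens C' D') (tmap f g)
    coalg_tmap_coprod coalg_tmap_counit.
End TensMap.

Lemma tassocK (U V W : lmodType K) : cancel (tassoc U V W) (tassocV U V W).
Proof.
by move=> x; tens_induct x as y w; tens_induct y; rewrite tassocE tassocVE.
Qed.
Lemma tassocVK (U V W : lmodType K) : cancel (tassocV U V W) (tassoc U V W).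
Proof.
by move=> x; tens_induct x as u y; tens_induct y; rewrite tassocVE tassocE.
Qed.
Lemma tlunitK (V : lmodType K) : cancel (tlunit V) (tlunitV V).
Proof.
move=> x; tens_induct x as a v; rewrite /= tlunitE pureZr -pureZl.
by congr (_ ⊗ₜ _); apply: mulr1.
Qed.
Lemma tlunitVK (V : lmodType K) : cancel (tlunitV V) (tlunit V).
Proof. by move=> v; rewrite /= tlunitE scale1r. Qed.
Lemma trunitK (V : lmodType K) : cancel (trunit V) (trunitV V).
Proof.
move=> x; tens_induct x as v a; rewrite /= trunitE pureZl -pureZr.
by congr (_ ⊗ₜ _); apply: mulr1.
Qed.
Lemma trunitVK (V : lmodType K) : cancel (trunitV V) (trunit V).
Proof. by move=> v; rewrite /= trunitE scale1r. Qed.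

Section InverseHom.
Variables (C D : coalgebra K) (f : coalg_hom C D) (g : {linear D -> C}).
Hypotheses (fK : cancel f g) (gK : cancel g f).
Fact coalg_inv_coprod d : coprod C (g d) = tmap g g (coprod D d).
Proof.
rewrite -{2}[d]gK coalg_map_coprod -tmap_comp.
have -> : lincomp g f = linid C by apply: linear_eqP => c; apply: fK.
by rewrite tmap_id.
Qed.
Fact coalg_inv_counit d : counit C (g d) = counit D d.
Proof. by rewrite -{2}[d]gK coalg_map_counit. Qed.
Definition coalg_inv : coalg_hom D C := CoalgHom coalg_inv_coprod coalg_inv_counit.
End InverseHom.

Section AssocHom.
Variables C D E : coalgebra K.
Let L := coalg_tens (coalg_tens C D) E.
Let R := coalg_tens C (coalg_tens D E).
Fact coalg_assoc_coprod (x : L) :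
  coprod R (tassoc C D E x) = tmap (tassoc _ _ _) (tassoc _ _ _) (coprod L x).
Proof.
tens_induct x as y e; tens_induct y as c d.
rewrite tassocE !ctens_coprodE.
move: (coprod C c) (coprod D d) (coprod E e) => p q r.
by tens_induct p; tens_induct q; tens_induct r; rewrite !(tswapE, tmapE, tassocE).
Qed.
Fact coalg_assoc_counit (x : L) : counit R (tassoc C D E x) = counit L x.
Proof.
tens_induct x as y e; tens_induct y as c d.
by rewrite tassocE !ctens_counitE scalerA.
Qed.
Definition coalg_assoc : coalg_hom L R :=
  @CoalgHom K L R (tassoc C D E) coalg_assoc_coprod coalg_assoc_counit.
Definition coalg_assocV : coalg_hom R L :=
  @coalg_inv L R coalg_assoc (tassocV C D E) (@tassocK _ _ _) (@tassocVK _ _ _).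
End AssocHom.

Section UnitHom.
Variable C : coalgebra K.
Let L := coalg_tens coalg_unit C.
Let R := coalg_tens C coalg_unit.
Fact coalg_lunit_coprod (x : L) :
  coprod C (tlunit C x) = tmap (tlunit C) (tlunit C) (coprod L x).
Proof.
tens_induct x as a c; rewrite tlunitE linearZ ctens_coprodE /=.
move: (coprod C c) => p; tens_induct p.
by rewrite tswapE tmapE !tlunitE scale1r pureZr.
Qed.
Fact coalg_lunit_counit (x : L) : counit C (tlunit C x) = counit L x.
Proof. by tens_induct x as a c; rewrite tlunitE linearZ ctens_counitE. Qed.
Definition coalg_lunit : coalg_hom L C :=
  @CoalgHom K L C (tlunit C) coalg_lunit_coprod coalg_lunit_counit.
Definition coalg_lunitV : coalg_hom C L :=
  @coalg_inv L C coalg_lunit (tlunitV C) (@tlunitK _) (@tlunitVK _).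

Fact coalg_runit_coprod (x : R) :
  coprod C (trunit C x) = tmap (trunit C) (trunit C) (coprod R x).
Proof.
tens_induct x as c a; rewrite trunitE linearZ ctens_coprodE /=.
move: (coprod C c) => p; tens_induct p.
by rewrite tswapE tmapE !trunitE scale1r pureZr.
Qed.
Fact coalg_runit_counit (x : R) : counit C (trunit C x) = counit R x.
Proof.
by tens_induct x as c a; rewrite trunitE linearZ ctens_counitE; apply: mulrC.
Qed.
Definition coalg_runit : coalg_hom R C :=
  @CoalgHom K R C (trunit C) coalg_runit_coprod coalg_runit_counit.
Definition coalg_runitV : coalg_hom C R :=
  @coalg_inv R C coalg_runit (trunitV C) (@trunitK _) (@trunitVK _).
End UnitHom.

End CoalgebraMonoidal.

Section CoalgebraCategory.
Variable K : fieldType.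

Fact coalg_comp1m (C D : coalgebra K) (f : coalg_hom C D) :
  coalg_comp (coalg_id C) f = f.
Proof. exact: coalg_hom_eq. Qed.
Fact coalg_compm1 (C D : coalgebra K) (f : coalg_hom C D) :
  coalg_comp f (coalg_id D) = f.
Proof. exact: coalg_hom_eq. Qed.
Fact coalg_compA (B C D E : coalgebra K)
    (f : coalg_hom B C) (g : coalg_hom C D) (h : coalg_hom D E) :
  coalg_comp f (coalg_comp g h) = coalg_comp (coalg_comp f g) h.
Proof. exact: coalg_hom_eq. Qed.

Definition coalg_cat : category :=
  Category coalg_comp1m coalg_compm1 coalg_compA.

Definition coalg_monoidal : monoidal.
Proof.
refine (@Monoidal coalg_cat (coalg_unit K) (@coalg_tens K) (@coalg_tmap K)
  (@coalg_assoc K) (@coalg_assocV K) (@coalg_lunit K) (@coalg_lunitV K)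
  (@coalg_runit K) (@coalg_runitV K) _ _ _ _ _ _ _ _ _ _ _ _ _).
- by move=> C D; apply: coalg_hom_eq => x; apply: tmap_id.
- by move=> C C' C'' D D' D'' f f' g g'; apply: coalg_hom_eq => x; apply: tmap_comp.
- by move=> C D E; apply: coalg_hom_eq; apply: tassocK.
- by move=> C D E; apply: coalg_hom_eq; apply: tassocVK.
- by move=> C; apply: coalg_hom_eq; apply: tlunitK.
- by move=> C; apply: coalg_hom_eq; apply: tlunitVK.
- by move=> C; apply: coalg_hom_eq; apply: trunitK.
- by move=> C; apply: coalg_hom_eq; apply: trunitVK.
- move=> C C' D D' E E' f g h; apply: coalg_hom_eq => x /=.
  tens_induct x as y e; tens_induct y as c d.
  by rewrite !(tassocE, tmapE).
- move=> C C' f; apply: coalg_hom_eq => x /=; tens_induct x as a c.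
  by rewrite tmapE !tlunitE linearZ.
- move=> C C' f; apply: coalg_hom_eq => x /=; tens_induct x as c a.
  by rewrite tmapE !trunitE linearZ.
- move=> B C D E; apply: coalg_hom_eq => x /=.
  tens_induct x as y e; tens_induct y as z d; tens_induct z as b c.
  by rewrite !(tassocE, tmapE) /= ?(tassocE, tmapE).
- move=> C D; apply: coalg_hom_eq => x /=.
  tens_induct x as y d; tens_induct y as c a.
  by rewrite !(tassocE, tmapE) /= tlunitE trunitE pureZr pureZl.
Defined.

End CoalgebraCategory.

Section Permutations.
Variable n : nat.

Fact block_perm_sum (k : 'I_n -> nat) (s : 'S_n) :
  (\sum_i k i = \sum_i k (s i))%N.
Proof. by rewrite (reindex_inj (@perm_inj _ s)). Qed.

Definition block_perm_fun (k : 'I_n -> nat) (s : 'S_n)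
    (p : 'I_(\sum_i k (s i))) : 'I_(\sum_i k (s i)) :=
  cast_ord (block_perm_sum k s) (tagnat.Rank (s (tagnat.sig1 p)) (tagnat.sig2 p)).

Fact block_perm_inj (k : 'I_n -> nat) (s : 'S_n) : injective (@block_perm_fun k s).
Proof.
move=> p q /cast_ord_inj /tagnat.rank_inj /eqP.
rewrite -[p]tagnat.sigK -[q]tagnat.sigK /tagnat.sig1 /tagnat.sig2 !tagnat.rankK.
case: (tagnat.sig p) (tagnat.sig q) => [i u] [j v] /=.
rewrite -tag_eqE /tag_eq /= => /andP[/eqP /perm_inj ij].
by subst j; rewrite tagged_asE => /eqP ->.
Qed.

(* The permutation of k_s(1) + ... + k_s(n) letters sending the j-th element of
   the i-th block to the j-th element of block s(i), the target being cut in
   blocks of sizes k_1, ..., k_n. *)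
Definition block_perm (k : 'I_n -> nat) (s : 'S_n) : 'S_(\sum_i k (s i)) := perm (@block_perm_inj k s).

Definition sum_perm_fun (k : 'I_n -> nat) (t : forall i, 'S_(k i))
    (p : 'I_(\sum_i k i)) : 'I_(\sum_i k i) :=
  tagnat.Rank (tagnat.sig1 p) (t _ (tagnat.sig2 p)).

Fact sum_perm_inj (k : 'I_n -> nat) (t : forall i, 'S_(k i)) : injective (@sum_perm_fun k t).
Proof.
move=> p q /tagnat.rank_inj /eqP.
rewrite -[p]tagnat.sigK -[q]tagnat.sigK /tagnat.sig1 /tagnat.sig2 !tagnat.rankK.
case: (tagnat.sig p) (tagnat.sig q) => [i u] [j v] /=.
rewrite -tag_eqE /tag_eq /= => /andP[/eqP ij].
by subst j; rewrite tagged_asE => /eqP /perm_inj ->.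
Qed.

(* t_1 ⊕ ... ⊕ t_n *)
Definition sum_perm (k : 'I_n -> nat) (t : forall i, 'S_(k i)) : 'S_(\sum_i k i) := perm (@sum_perm_inj k t).

End Permutations.

Record operad_data (K : fieldType) := OperadData {
  op_space :> nat -> lmodType K;
  op_act : forall n, 'S_n -> {linear op_space n -> op_space n};
  op_unit : {linear K^o -> op_space 1};
  op_comp : forall n (k : 'I_n.+1 -> nat),
    {linear op_space n.+1 ⊗ tensn (fun i => op_space (k i))
            -> op_space (\sum_i k i)%N} }.

Arguments op_act {K O n} s : rename.
Arguments op_unit {K O} : rename.
Arguments op_comp {K O n} k : rename.

Fact sum_ord0 (k : 'I_0 -> nat) : (0 = \sum_i k i)%N.
Proof. by rewrite big_ord0. Qed.

(* γ(θ; d_1, ..., d_n), extended by γ(θ; ) = θ for θ of arity 0.  The associativity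
   axiom needs this convention when some arities k_i vanish. *)
Definition ocomp (K : fieldType) (O : operad_data K) n :
    forall k : 'I_n -> nat, O n -> (forall i, O (k i)) -> O (\sum_i k i)%N :=
  match n with
  | 0 => fun k θ _ => ecast m (O m) (sum_ord0 k) θ
  | n'.+1 => fun k θ d => op_comp k (θ ⊗ₜ puren d)
  end.

(* Elements of O(m) and O(m'), with m and m' equal but not convertible, are
   compared in the disjoint union of the O(m). *)
Definition same_op (K : fieldType) (O : operad_data K) m m' (x : O m) (y : O m') :=
  existT (fun l => O l) m x = existT (fun l => O l) m' y.

(* Permutations compose from left to right in the library: [(t * s)%g] is s ∘ t.
   The equivariance axioms are those satisfied by multilinear maps for the left
   action (s f)(a_1, ..., a_n) = f(a_s(1), ..., a_s(n)); right actions are turned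
   into left ones by inverting permutations. *)
Record operad (K : fieldType) := Operad {
  op_data :> operad_data K;
  op_act1 : forall n (θ : op_data n), op_act 1%g θ = θ;
  op_actM : forall n (s t : 'S_n) (θ : op_data n),
    op_act (t * s)%g θ = op_act s (op_act t θ);
  op_assoc : forall n (k : 'I_n -> nat) (l : 'I_(\sum_i k i) -> nat)
    (θ : op_data n) (d : forall i, op_data (k i)) (e : forall p, op_data (l p)),
    same_op (ocomp (ocomp θ d) e)
            (ocomp θ (fun i => ocomp (d i) (fun j => e (tagnat.Rank i j))));
  op_unitl : forall k (θ : op_data k),
    same_op (ocomp (op_unit 1) (fun _ : 'I_1 => θ)) θ;
  op_unitr : forall n (θ : op_data n),
    same_op (ocomp θ (fun _ : 'I_n => op_unit 1)) θ;
  op_equiv_outer : forall n (k : 'I_n -> nat) (s : 'S_n)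
    (θ : op_data n) (d : forall i, op_data (k i)),
    same_op (ocomp (op_act s θ) d)
            (op_act (block_perm k s) (ocomp θ (fun i => d (s i))));
  op_equiv_inner : forall n (k : 'I_n -> nat) (t : forall i, 'S_(k i))
    (θ : op_data n) (d : forall i, op_data (k i)),
    ocomp θ (fun i => op_act (t i) (d i)) = op_act (sum_perm t) (ocomp θ d) }.

Record opalg (K : fieldType) (O : operad K) := OpAlg {
  alg_space :> lmodType K;
  alg_act : forall n, {linear O n ⊗ tensn (fun _ : 'I_n => alg_space) -> alg_space};
  alg_assoc : forall n (k : 'I_n.+1 -> nat) (θ : O n.+1) (d : forall i, O (k i))
    (a : 'I_(\sum_i k i) -> alg_space),
    alg_act _ (op_comp k (θ ⊗ₜ puren d) ⊗ₜ puren a)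
    = alg_act _ (θ ⊗ₜ puren (fun i =>
        alg_act _ (d i ⊗ₜ puren (fun j => a (tagnat.Rank i j)))));
  alg_unit : forall a : alg_space,
    alg_act _ (op_unit 1 ⊗ₜ puren (fun _ : 'I_1 => a)) = a;
  alg_equiv : forall n (s : 'S_n) (θ : O n) (a : 'I_n -> alg_space),
    alg_act _ (op_act s θ ⊗ₜ puren a) = alg_act _ (θ ⊗ₜ puren (fun i => a (s i))) }.

Arguments alg_act {K O A n} : rename.

Definition alg_u (K : fieldType) (O : operad K) (A : opalg O) (θ : O 0) : A :=
  alg_act (θ ⊗ₜ (1 : K^o)).

Record opalg_hom (K : fieldType) (O : operad K) (A B : opalg O) := OpAlgHom {
  opalg_map :> {linear A -> B};
  opalg_map_act : forall n (θ : O n) (a : 'I_n -> A),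
    opalg_map (alg_act (θ ⊗ₜ puren a)) = alg_act (θ ⊗ₜ puren (fun i => opalg_map (a i))) }.

Section OpalgCategory.
Variables (K : fieldType) (O : operad K).

Lemma opalg_hom_eq (A B : opalg O) (f g : opalg_hom A B) :
  (forall a, f a = g a) -> f = g.
Proof.
case: f g => [f f1] [g g1] /= /linear_eqP fg; subst g.
by rewrite (Prop_irrelevance f1 g1).
Qed.

Definition opalg_id (A : opalg O) : opalg_hom A A :=
  @OpAlgHom K O A A (linid A) (fun n θ a => erefl).

Fact opalg_comp_act (A B D : opalg O) (f : opalg_hom A B) (g : opalg_hom B D)
    n (θ : O n) (a : 'I_n -> A) :
  lincomp g f (alg_act (θ ⊗ₜ puren a))
  = alg_act (θ ⊗ₜ puren (fun i => lincomp g f (a i))).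
Proof. by rewrite /= !opalg_map_act. Qed.
Definition opalg_comp (A B D : opalg O) (f : opalg_hom A B) (g : opalg_hom B D) :
  opalg_hom A D := OpAlgHom (opalg_comp_act f g).

Fact opalg_comp1m (A B : opalg O) (f : opalg_hom A B) :
  opalg_comp (opalg_id A) f = f.
Proof. exact: opalg_hom_eq. Qed.
Fact opalg_compm1 (A B : opalg O) (f : opalg_hom A B) :
  opalg_comp f (opalg_id B) = f.
Proof. exact: opalg_hom_eq. Qed.
Fact opalg_compA (A B D E : opalg O)
    (f : opalg_hom A B) (g : opalg_hom B D) (h : opalg_hom D E) :
  opalg_comp f (opalg_comp g h) = opalg_comp (opalg_comp f g) h.
Proof. exact: opalg_hom_eq. Qed.

Definition opalg_cat : category :=
  Category opalg_comp1m opalg_compm1 opalg_compA.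

End OpalgCategory.

(* Δ^n : C -> C^{⊗ n+1}; as [tensn] ends with a factor K, Δ^0 is c |-> c ⊗ 1. *)
Fixpoint icoprod (K : fieldType) (C : coalgebra K) n :
    {linear C -> tensn (fun _ : 'I_n.+1 => C : lmodType K)} :=
  match n with
  | 0 => trunitV C
  | n'.+1 => lincomp (tmap (linid C) (icoprod C n')) (coprod C)
  end.

Record measuring (K : fieldType) (O : operad K) (C : coalgebra K) (A B : opalg O) :=
  Measuring {
  meas_map :> {linear C -> homK A B};
  meas_act : forall n (θ : O n.+1) (a : 'I_n.+1 -> A) (c : C),
    (meas_map c : {linear A -> B}) (alg_act (θ ⊗ₜ puren a))
    = alg_act (θ ⊗ₜ tmapn (fun i => lincomp (hom_eval (a i)) meas_map) (icoprod C n c));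
  meas_unit : forall (θ : O 0) (c : C),
    (meas_map c : {linear A -> B}) (alg_u A θ) = (counit C c : K) *: alg_u B θ }.

Definition universal_measuring (K : fieldType) (O : operad K) (A B : opalg O)
    (M : coalgebra K) (Phi : measuring M A B) :=
  forall (C : coalgebra K) (phi : measuring C A B),
    exists! psi : coalg_hom C M, forall c, Phi (psi c) = phi c.

(* Main.v *)
Require Import Defs.
From HB Require Import structures.
From mathcomp Require Import all_boot all_order all_fingroup all_algebra.
From mathcomp Require Import boolp classical_sets functions.

Set Implicit Arguments.
Unset Strict Implicit.
Unset Printing Implicit Defensive.

Import GRing.Theory.
Local Open Scope ring_scope.

(** A measuring is determined by scalar observations.  Write [V] for
    [Hom(A, B)].  A measuring [phi : C -> V] turns a word [xi_1 ... xi_n] of linear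
    functionals on [V] into the functional
    [c |-> xi_1 (phi c_1) * ... * xi_n (phi c_n)] on [C], so each [c] becomes a
    scalar function on words, its behaviour.  The coalgebra [M(A, B)] is the space
    spanned by the behaviours of all elements of all measurings from [A] to [B]
    ([behaviour], [beh_coalg]).

    The coproduct is deconcatenation of words: for [m] in [M(A, B)], the function
    [(s, t) |-> m (s ++ t)] comes from a tensor in [M ⊗ M], because for the
    behaviour of [c] it comes from the coproduct of [c] ([obs_cat]), and the tensor is
    unique because products of separating functionals separate a tensor product
    ([separating_tens]).  Evaluation at the empty word is the counit, and the coalgebra
    axioms become the monoid laws of concatenation.  The values of [m] at words of
    length one are the values of functionals at a vector of [V], unique since
    functionals separate points ([dual_separating]); this vector is the image of [m]
    under the universal measuring.  The measuring laws are linear in [m], so it is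
    enough to check them on behaviours, where they are the laws of the measuring that
    produced the behaviour.

    Every measuring factors through [M(A, B)] by taking behaviours.  Conversely, the
    value of [m] at a word [s] is the observation of [m] itself along [s]
    ([obs_beh_measuring]), and morphisms of measurings preserve observations
    ([obs_hom]); hence the factorization is unique.

    For the enrichment, measurings compose ([meas_comp]), and an algebra morphism is
    the same thing as a measuring by the coalgebra [K] ([meas_hom], [hom_meas]).  Two
    coalgebra morphisms into a universal measuring coalgebra agree as soon as they
    induce the same maps between algebras ([universal_ext]), and this reduces the
    axioms of an enriched category to the associativity and unitality of the
    composition of linear maps. *)

(** * Linear functionals *)

Section Functionals.
Variable K : fieldType.
Implicit Types U V W : lmodType K.

Definition dual V := {linear V -> K^o}.

(** A subspace that is maximal among those avoiding [v] is a complement of the line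
    spanned by [v]; the functional is the coordinate along that line. *)
Lemma functional_nonzero V (v : V) : v <> 0 -> exists f : dual V, f v = 1.
Proof.
move=> v0.
pose avoids (A : set V) := (forall a x y, A x -> A y -> A (a *: x + y)) /\ ~ A v.
have [A [[Alin Av] Amax]] :
    exists A, avoids A /\ forall B, (A `<` B)%classic -> ~ avoids B.
  apply: Zorn_bigcup => F FP Ftot; split; last by case=> X /FP[].
  move=> a x y [X FX Xx] [Y FY Yy].
  have [Z FZ [Zx Zy]] : exists2 Z, F Z & Z x /\ Z y.
    by case: (Ftot X Y FX FY) => XY; [exists Y | exists X] => //; split=> //; apply: XY.
  by exists Z => //; apply: (FP Z FZ).1.
(* The empty chain forces the condition to hold for the empty set, so that [A]
   contains 0 only by maximality. *)
have A0 : A 0.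
  apply: contrapT => nA0; apply: (Amax (fun x => x = 0)).
    split=> [x Ax|/(_ 0 erefl)//]; case: nA0.
    by have := Alin (-1) x x Ax Ax; rewrite scaleN1r addNr.
  by split=> [a x y -> ->|/v0//]; rewrite scaler0 addr0.
(* If [w] is not in [A], then maximality puts [v] in the span of [A] and [w]. *)
have coord w : exists a, A (w - a *: v).
  have [Aw|nAw] := pselect (A w); first by exists 0; rewrite scale0r subr0.
  have /not_andP[nlin|/contrapT[b Av']] : ~ avoids (fun x => exists b, A (x - b *: w)).
  - apply: Amax; split=> [x Ax|/(_ w) h]; first by exists 0; rewrite scale0r subr0.
    by apply/nAw/h; exists 1; rewrite scale1r subrr.
  - case: nlin => a x y [b Ax] [c Ay]; exists (a * b + c).
    have := Alin a _ _ Ax Ay.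
    by rewrite scalerBr scalerDl -scalerA opprD addrACA.
  have b0 : b != 0 by apply/eqP => b0; apply: Av; move: Av'; rewrite b0 scale0r subr0.
  exists b^-1; have := Alin (- b^-1) _ _ Av' A0.
  by rewrite addr0 scalerBr !scaleNr opprK scalerA mulVf // scale1r addrC.
have coord_uniq w a b : A (w - a *: v) -> A (w - b *: v) -> a = b.
  move=> Aa Ab; apply: contrapT => /eqP; rewrite -subr_eq0 => ab; apply: Av.
  have Aba : A ((a - b) *: v).
    have := Alin (-1) _ _ Aa Ab.
    by rewrite scaleN1r opprB addrA subrK scalerBl.
  by have := Alin (a - b)^-1 _ _ Aba A0; rewrite addr0 scalerA mulVf // scale1r.
have [f fP] := choice coord.
have flin : linear (f : V -> K^o).
  move=> a x y; apply: (coord_uniq (a *: x + y)) => //.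
  have := Alin a _ _ (fP x) (fP y).
  by rewrite scalerBr addrACA -opprD scalerA -scalerDl.
exists (mklin flin); apply: (coord_uniq v) => //.
by rewrite scale1r subrr.
Qed.

Definition separating V (S : Type) (e : S -> dual V) :=
  forall v, (forall s, e s v = 0) -> v = 0.

Lemma separating_eq V S (e : S -> dual V) v w :
  separating e -> (forall s, e s v = e s w) -> v = w.
Proof. by move=> sep vw; apply/subr0_eq/sep => s; rewrite linearB vw subrr. Qed.

Lemma dual_separating V : separating (fun f : dual V => f).
Proof.
move=> v h; apply: contrapT => /functional_nonzero[f fv].
by have := h f; rewrite fv => /eqP; rewrite oner_eq0.
Qed.

Fact id_separating : separating (fun _ : unit => linid K^o).
Proof. by move=> a /(_ tt). Qed.

Fact dual_tens_bilinear V W (f : dual V) (g : dual W) :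
  is_bilinear (fun v w => (f v : K) * g w : K^o).
Proof.
split=> [w|v] a x y; rewrite linearP; first by rewrite mulrDl -mulrA.
by rewrite mulrDr mulrCA.
Qed.

Definition dual_tens V W (f : dual V) (g : dual W) : dual (V ⊗ W) :=
  tens_lift (dual_tens_bilinear f g).

Lemma dual_tensE V W (f : dual V) (g : dual W) v w :
  dual_tens f g (v ⊗ₜ w) = (f v : K) * g w.
Proof. exact: tens_liftE. Qed.

Lemma dual_tens_tmap V V' W W' (f : dual V') (g : dual W')
    (p : {linear V -> V'}) (q : {linear W -> W'}) x :
  dual_tens f g (tmap p q x) = dual_tens (lincomp f p) (lincomp g q) x.
Proof. by tens_induct x; rewrite tmapE !dual_tensE. Qed.

Lemma dual_tens_assoc U V W (f : dual U) (g : dual V) (h : dual W) x :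
  dual_tens f (dual_tens g h) (tassoc U V W x) = dual_tens (dual_tens f g) h x.
Proof.
tens_induct x as y w; tens_induct y as u v.
by rewrite tassocE !dual_tensE mulrA.
Qed.

(** Induction on the length of a formal sum [v ⊗ w + ...]: when [e s0 v] is nonzero,
    applying [e s0] to the left factors expresses [w] through the other right
    factors, so that the sum can be rewritten with one term less. *)
Lemma separating_tens V W S T (e : S -> dual V) (e' : T -> dual W) :
  separating e -> separating e' ->
  separating (fun st => dual_tens (e st.1) (e' st.2)).
Proof.
move=> sep sep' x; rewrite (tens_rep_sum x).
have [n] := ubnP (size (tens_rep x)); elim: n (tens_rep x) => // n IH [|[v w] r] /= rn h.
  by rewrite big_nil.
rewrite big_cons /=; have [v0|/eqP nv0] := pselect (v = 0).
  move: h; rewrite big_cons /= v0 pure0l add0r; exact: IH.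
have [s0 s0v] : exists s0, e s0 v != 0.
  apply: contrapT => /forallNP all0; case/eqP: nv0; apply: sep => s.
  by apply/eqP/negPn/negP/all0.
pose c u : K := (e s0 v : K)^-1 * e s0 u.
have wE : w = - \sum_(p <- r) c p.1 *: p.2.
  apply: (separating_eq sep') => t; have := h (s0, t).
  rewrite big_cons linearD dual_tensE /= => /(canRL (addrK _)); rewrite sub0r.
  move=> /(canRL (mulKf s0v)) ->; rewrite mulrN linearN; congr (- _).
  rewrite !linear_sum mulr_sumr; apply: eq_bigr => p _.
  by rewrite dual_tensE linearZ /= mulrA.
have rE : v ⊗ₜ w + \sum_(p <- r) p.1 ⊗ₜ p.2
    = \sum_(p <- [seq (p.1 - c p.1 *: v, p.2) | p <- r]) p.1 ⊗ₜ p.2.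
  rewrite big_map wE -scaleN1r pureZr scaleN1r.
  have -> : v ⊗ₜ (\sum_(p <- r) c p.1 *: p.2) = \sum_(p <- r) (c p.1 *: v) ⊗ₜ p.2.
    elim: (r) => [|p q IHq]; first by rewrite !big_nil pure0r.
    by rewrite !big_cons pureDr IHq pureZr pureZl.
  rewrite addrC -sumrB; apply: eq_bigr => p _.
  by rewrite [in RHS]pureDl -[- (c _ *: v)]scaleN1r [in RHS]pureZl scaleN1r.
rewrite rE; apply: IH; first by rewrite size_map.
by move=> st; rewrite -rE -(h st) big_cons.
Qed.
End Functionals.

(** * Words of functionals observing a coalgebra *)

Section Observation.
Variables (K : fieldType) (V : lmodType K).

Section Obs.
Variables (C : coalgebra K) (phi : {linear C -> V}).

(** The convolution product of the functionals [xi \o phi], for [xi] in [s]. *)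
Fixpoint obs (s : seq (dual V)) : dual C :=
  match s with
  | [::] => counit C
  | xi :: s' => lincomp (dual_tens (lincomp xi phi) (obs s')) (coprod C)
  end.

(** Associativity and the unit law of convolution, which are dual to the coalgebra
    axioms. *)
Lemma obs_cat s t c : dual_tens (obs s) (obs t) (coprod C c) = obs (s ++ t) c.
Proof.
elim: s c => [|xi s IH] c /=.
  transitivity (dual_tens (linid K^o) (obs t) (tmap (counit C) (linid C) (coprod C c))).
    by rewrite dual_tens_tmap; congr (dual_tens _ _ _); apply: linear_eqP.
  by rewrite counitl dual_tensE mul1r.
transitivity (dual_tens (dual_tens (lincomp xi phi) (obs s)) (obs t)
                (tmap (coprod C) (linid C) (coprod C c))).
  by rewrite dual_tens_tmap; congr (dual_tens _ _ _); apply: linear_eqP.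
rewrite -dual_tens_assoc coprodA dual_tens_tmap.
by congr (dual_tens _ _ _); apply: linear_eqP => x //=; apply: IH.
Qed.

Lemma obs1 xi c : obs [:: xi] c = xi (phi c).
Proof.
transitivity (dual_tens (lincomp xi phi) (linid K^o)
                (tmap (linid C) (counit C) (coprod C c))).
  by rewrite dual_tens_tmap; congr (dual_tens _ _ _); apply: linear_eqP.
by rewrite counitr dual_tensE mulr1.
Qed.
End Obs.

Lemma obs_hom (C D : coalgebra K) (f : coalg_hom C D)
    (phi : {linear C -> V}) (chi : {linear D -> V}) s c :
  (forall c, chi (f c) = phi c) -> obs chi s (f c) = obs phi s c.
Proof.
move=> fP; elim: s c => [|xi s IH] c /=; first exact: coalg_map_counit.
rewrite coalg_map_coprod dual_tens_tmap.
by congr (dual_tens _ _ _); apply: linear_eqP => x /=; rewrite ?fP ?IH.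
Qed.

End Observation.

(** * Iterated coproducts *)

Section TensorPowers.
Variable K : fieldType.

Lemma tmapn_comp n (U V W : 'I_n -> lmodType K)
    (g : forall i, {linear V i -> W i}) (f : forall i, {linear U i -> V i}) x :
  tmapn g (tmapn f x) = tmapn (fun i => lincomp (g i) (f i)) x.
Proof.
elim: n U V W g f x => [|n IH] U V W g f x //=.
by rewrite -tmap_comp; congr (tmap _ _ _); apply: linear_eqP => y /=; rewrite IH.
Qed.

Lemma eq_tmapn n (V W : 'I_n -> lmodType K) (f g : forall i, {linear V i -> W i}) x :
  (forall i, f i =1 g i) -> tmapn f x = tmapn g x.
Proof.
by move=> fg; congr (tmapn _ x); apply: functional_extensionality_dep => i;
   apply: linear_eqP.
Qed.

Notation tpow n V := (tensn (fun _ : 'I_n => V)).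

(** The hypotheses are on bare functions, rather than bundled linear maps, so that
    the lemma applies to expressions that are linear in one of their arguments. *)
Lemma tpow_ext n (V W : lmodType K) (f g : tpow n V -> W) :
  linear f -> linear g -> (forall v : 'I_n -> V, f (puren v) = g (puren v)) -> f =1 g.
Proof.
elim: n f g => [|n IH] f g flin glin fg.
  move=> a; have aE : a = (a : K) *: (1 : K^o) by apply/esym/mulr1.
  rewrite -[f]/(mklin flin : _ -> _) -[g]/(mklin glin : _ -> _) aE !linearZ /=.
  by rewrite (fg (fun i : 'I_0 => 0)).
suff /(congr1 (fun h : {linear _ -> _} => h : _ -> _)) /= -> :
  mklin flin = mklin glin by [].
apply: tens_ext => v w; move: w.
have lin (h : tpow n.+1 V -> W) : linear h -> linear (fun w => h (v ⊗ₜ w)).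
  by move=> hlin a x1 x2; rewrite pureDr pureZr hlin.
apply: IH (lin _ flin) (lin _ glin) _ => u /=.
have := fg (fun i => if unlift ord0 i is Some j then u j else v).
rewrite /= unlift_none.
by have -> : (fun i => if unlift ord0 (lift ord0 i) is Some j then u j else v) = u
  by apply/funext => i; rewrite liftK.
Qed.

Lemma icoprod_hom n (C D : coalgebra K) (f : coalg_hom C D) c :
  icoprod D n (f c) = tmapn (fun _ => coalg_map f) (icoprod C n c).
Proof.
elim: n c => [|n IH] c /=; first by rewrite tmapE.
rewrite coalg_map_coprod -!tmap_comp.
by congr (tmap _ _ _); apply: linear_eqP => x //=; apply: IH.
Qed.

(** The interchange map that relates the iterated coproduct of [C ⊗ D] to those of [C]
    and [D]. *)
Fixpoint tzip n (V W : lmodType K) : {linear tpow n V ⊗ tpow n W -> tpow n (V ⊗ W)} :=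
  match n with
  | 0 => tlunit K^o
  | n'.+1 => lincomp (tmap (linid (V ⊗ W)) (tzip n' V W)) (tswap _ _ _ _)
  end.

Lemma tzipE n (V W : lmodType K) (v : 'I_n -> V) (w : 'I_n -> W) :
  tzip n V W (puren v ⊗ₜ puren w) = puren (fun i => v i ⊗ₜ w i).
Proof.
elim: n v w => [|n IH] v w /=; first by rewrite tlunitE; apply: mulr1.
by rewrite tswapE tmapE; congr (_ ⊗ₜ _); apply: IH.
Qed.

Lemma icoprod_tens n (C D : coalgebra K) c d :
  icoprod (coalg_tens C D) n (c ⊗ₜ d)
  = tzip n.+1 C D (icoprod C n c ⊗ₜ icoprod D n d).
Proof.
elim: n c d => [|n IH] c d /=.
  by rewrite tswapE tmapE tlunitE scale1r.
rewrite tmapE; move: (coprod C c) (coprod D d) => x y.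
tens_induct x; tens_induct y; rewrite tswapE !tmapE /= tswapE tmapE.
by congr (_ ⊗ₜ _); apply: IH.
Qed.

Lemma icoprod_unit n (a : K^o) :
  icoprod (coalg_unit K) n a = (a : K) *: puren (fun _ : 'I_n.+1 => 1 : K^o).
Proof.
have aE : a = (a : K) *: (1 : K^o) by apply/esym/mulr1.
rewrite {1}aE linearZ; congr (_ *: _).
elim: n => [|n IH] //=; rewrite tmapE; congr (_ ⊗ₜ _); exact: IH.
Qed.

End TensorPowers.

(** * The coalgebra of behaviours *)

Section Universal.
Variables (K : fieldType) (O : operad K) (A B : opalg O).

Let word := seq (dual (homK A B)).

(** The span of the functions [s |-> obs phi s c], where [C] ranges over all
    coalgebras.  Being a proposition, it may quantify over all of them while the space
    that it cuts out stays a subspace of the functions on words. *)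
Inductive behaviour : (word -> K^o) -> Prop :=
| behaviour_obs (C : coalgebra K) (phi : measuring C A B) c :
    behaviour (fun s => obs phi s c)
| behaviour0 : behaviour 0
| behaviourD f g : behaviour f -> behaviour g -> behaviour (f + g).

Definition behaviours : {pred (word -> K^o)} := fun f => `[< behaviour f >].

Fact behaviours_submod : submod_closed behaviours.
Proof.
split=> [|a f g /asboolP hf /asboolP hg]; first by apply/asboolP/behaviour0.
apply/asboolP/behaviourD => //; elim: hf => [C phi c||f1 f2 _ h1 _ h2].
- have -> : a *: (fun s => obs phi s c : K^o) = fun s => obs phi s (a *: c).
    by apply/funext => s; rewrite linearZ.
  exact: behaviour_obs.
- by rewrite scaler0; apply: behaviour0.
- by rewrite scalerDr; apply: behaviourD.
Qed.

HB.instance Definition _ :=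
  GRing.isSubmodClosed.Build K (word -> K^o) behaviours behaviours_submod.

Record beh := Beh { beh_fun :> word -> K^o; _ : beh_fun \in behaviours }.
HB.instance Definition _ := [isSub for beh_fun].
HB.instance Definition _ := [Choice of beh by <:].
HB.instance Definition _ := [SubChoice_isSubLmodule of beh by <:].

Definition beh_space : lmodType K := beh.

Fact beh_ev_linear s : linear (fun m : beh_space => (m : beh) s : K^o).
Proof. by []. Qed.
Definition beh_ev s : dual beh_space := mklin (beh_ev_linear s).

Lemma beh_ev_sep : separating beh_ev.
Proof. by move=> m h; apply/val_inj/funext => s; apply: h. Qed.

Section Observe.
Variables (C : coalgebra K) (phi : measuring C A B).

Fact observe_subproof c : (fun s => obs phi s c : K^o) \in behaviours.
Proof. exact/asboolP/behaviour_obs. Qed.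
Fact observe_linear : linear (fun c => Beh (observe_subproof c) : beh_space).
Proof. by move=> a x y; apply/val_inj/funext => s /=; rewrite linearP. Qed.
Definition observe : {linear C -> beh_space} := mklin observe_linear.

Lemma beh_ev_observe s c : beh_ev s (observe c) = obs phi s c.
Proof. by []. Qed.
End Observe.

Lemma beh_ind (Q : beh_space -> Prop) :
  Q 0 -> (forall C (phi : measuring C A B) c, Q (observe phi c)) ->
  (forall x y, Q x -> Q y -> Q (x + y)) -> forall m, Q m.
Proof.
move=> Q0 Qobs QD [f fP]; have /asboolP h := fP.
elim: h fP => [C phi c fP||f1 f2 h1 IH1 h2 IH2 fP].
- have -> : Beh fP = observe phi c by apply/val_inj.
  exact: Qobs.
- by move=> fP; have -> : Beh fP = 0 by apply/val_inj.
- have f1P : f1 \in behaviours by apply/asboolP.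
  have f2P : f2 \in behaviours by apply/asboolP.
  have -> : Beh fP = (Beh f1P : beh_space) + (Beh f2P : beh_space) by apply/val_inj.
  exact: QD.
Qed.

Lemma beh_ext (W : lmodType K) (f g : {linear beh_space -> W}) :
  (forall C (phi : measuring C A B) c, f (observe phi c) = g (observe phi c)) ->
  forall m, f m = g m.
Proof.
by move=> h; elim/beh_ind => // [|x y hx hy]; rewrite ?linear0 // !linearD hx hy.
Qed.

(** The functionals [e s] are coordinates on [W], in which the map to construct is
    [L]; they determine vectors, hence linearity, and a vector with prescribed
    coordinates has to be exhibited only for the behaviours of elements.  This provides
    both the coproduct and the universal measuring. *)
Lemma beh_factor (W : lmodType K) S (e : S -> dual W) (L : S -> dual beh_space) :
  separating e ->
  (forall C (phi : measuring C A B) c, exists w, forall s, e s w = L s (observe phi c)) ->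
  exists g : {linear beh_space -> W}, forall s m, e s (g m) = L s m.
Proof.
move=> sep h.
have /choice[g gP] : forall m, exists w, forall s, e s w = L s m.
  elim/beh_ind => [|//|x y [v hv] [w hw]]; first by exists 0 => s; rewrite !linear0.
  by exists (v + w) => s; rewrite !linearD hv hw.
have lin : linear g.
  by move=> a x y; apply: (separating_eq sep) => s; rewrite linearP !gP linearP.
by exists (mklin lin).
Qed.

Fact beh_coprod_subproof : exists D : {linear beh_space -> beh_space ⊗ beh_space},
  forall st m, dual_tens (beh_ev st.1) (beh_ev st.2) (D m) = beh_ev (st.1 ++ st.2) m.
Proof.
apply: beh_factor (separating_tens beh_ev_sep beh_ev_sep) _ => C phi c.
exists (tmap (observe phi) (observe phi) (coprod C c)) => -[s t].
rewrite dual_tens_tmap beh_ev_observe -obs_cat.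
by congr (dual_tens _ _ _); apply: linear_eqP.
Qed.
Definition beh_coprod := projT1 (cid beh_coprod_subproof).
Definition beh_counit : dual beh_space := beh_ev [::].

Lemma beh_coprodE s t m :
  dual_tens (beh_ev s) (beh_ev t) (beh_coprod m) = beh_ev (s ++ t) m.
Proof. exact: (projT2 (cid beh_coprod_subproof) (s, t) m). Qed.

Fact beh_coprodA m : tassoc _ _ _ (tmap beh_coprod (linid _) (beh_coprod m))
  = tmap (linid _) beh_coprod (beh_coprod m).
Proof.
apply: (separating_eq
  (separating_tens beh_ev_sep (separating_tens beh_ev_sep beh_ev_sep))).
case=> s [t u] /=; rewrite dual_tens_assoc !dual_tens_tmap.
have lin1 : lincomp (dual_tens (beh_ev s) (beh_ev t)) beh_coprod = beh_ev (s ++ t).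
  by apply: linear_eqP => x; apply: beh_coprodE.
have lin2 : lincomp (dual_tens (beh_ev t) (beh_ev u)) beh_coprod = beh_ev (t ++ u).
  by apply: linear_eqP => x; apply: beh_coprodE.
have lincompid (W : lmodType K) (f : dual W) : lincomp f (linid W) = f.
  exact: linear_eqP.
by rewrite lin1 lin2 !lincompid !beh_coprodE catA.
Qed.

Fact beh_counitl m : tmap beh_counit (linid _) (beh_coprod m) = (1 : K^o) ⊗ₜ m.
Proof.
apply: separating_eq (separating_tens (@id_separating K) beh_ev_sep) _ => -[[] s] /=.
rewrite dual_tens_tmap dual_tensE mul1r -[s in RHS]/([::] ++ s) -beh_coprodE.
by congr (dual_tens _ _ _); apply: linear_eqP.
Qed.

Fact beh_counitr m : tmap (linid _) beh_counit (beh_coprod m) = m ⊗ₜ (1 : K^o).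
Proof.
apply: separating_eq (separating_tens beh_ev_sep (@id_separating K)) _ => -[s []] /=.
rewrite dual_tens_tmap dual_tensE mulr1 -[s in RHS]cats0 -beh_coprodE.
by congr (dual_tens _ _ _); apply: linear_eqP.
Qed.

Definition beh_coalg : coalgebra K := Coalgebra beh_coprodA beh_counitl beh_counitr.

Section ObserveHom.
Variables (C : coalgebra K) (phi : measuring C A B).

Fact observe_coprod c :
  beh_coprod (observe phi c) = tmap (observe phi) (observe phi) (coprod C c).
Proof.
apply: separating_eq (separating_tens beh_ev_sep beh_ev_sep) _ => -[s t].
rewrite beh_coprodE dual_tens_tmap beh_ev_observe -obs_cat.
by congr (dual_tens _ _ _); apply: linear_eqP.
Qed.

Definition observe_hom : coalg_hom C beh_coalg :=
  @CoalgHom K C beh_coalg (observe phi) observe_coprod (fun=> erefl).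
End ObserveHom.

Fact beh_map_subproof : exists Phi : {linear beh_space -> homK A B},
  forall (xi : dual (homK A B)) m, xi (Phi m) = beh_ev [:: xi] m.
Proof.
apply: (beh_factor (L := fun xi : dual (homK A B) => beh_ev [:: xi])
  (@dual_separating K (homK A B))) => C phi c.
by exists (phi c) => xi; rewrite beh_ev_observe obs1.
Qed.
Definition beh_map := projT1 (cid beh_map_subproof).

Lemma beh_mapE (xi : dual (homK A B)) m : xi (beh_map m) = beh_ev [:: xi] m.
Proof. exact: (projT2 (cid beh_map_subproof) xi m). Qed.

Lemma beh_map_observe C (phi : measuring C A B) c : beh_map (observe phi c) = phi c.
Proof.
apply: (separating_eq (@dual_separating K (homK A B))) => xi.
by rewrite beh_mapE beh_ev_observe obs1.
Qed.

Fact beh_map_act n (θ : O n.+1) (a : 'I_n.+1 -> A) (m : beh_coalg) :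
  (beh_map m : {linear A -> B}) (alg_act (θ ⊗ₜ puren a))
  = alg_act (θ ⊗ₜ tmapn (fun i => lincomp (hom_eval (a i)) beh_map)
                    (icoprod beh_coalg n m)).
Proof.
have rhs_lin : linear (fun m => alg_act (θ ⊗ₜ
    tmapn (fun i => lincomp (hom_eval (a i)) beh_map) (icoprod beh_coalg n m)) : B).
  by move=> k x y; rewrite !linearP pureDr pureZr linearP.
rewrite -[LHS]/(lincomp (hom_eval (alg_act (θ ⊗ₜ puren a))) beh_map m).
rewrite -[RHS]/(mklin rhs_lin m); move: m; apply: beh_ext => C phi c /=.
rewrite beh_map_observe meas_act (icoprod_hom _ (observe_hom phi)).
congr (alg_act (_ ⊗ₜ _)).
apply: etrans (esym (tmapn_comp (fun i => lincomp (hom_eval (a i)) beh_map)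
  (fun _ => observe phi) (icoprod C n c))).
by apply: eq_tmapn => i x /=; rewrite beh_map_observe.
Qed.

Fact beh_map_unit (θ : O 0) (m : beh_coalg) :
  (beh_map m : {linear A -> B}) (alg_u A θ) = (counit beh_coalg m : K) *: alg_u B θ.
Proof.
have rhs_lin : linear (fun m => (counit beh_coalg m : K) *: alg_u B θ).
  by move=> k x y; rewrite linearP scalerDl scalerA.
rewrite -[LHS]/(lincomp (hom_eval (alg_u A θ)) beh_map m) -[RHS]/(mklin rhs_lin m).
by move: m; apply: beh_ext => C phi c /=; rewrite beh_map_observe meas_unit.
Qed.

Definition beh_measuring : measuring beh_coalg A B := Measuring beh_map_act beh_map_unit.

(** A behaviour is recovered from the universal measuring: evaluation at a word is the
    observation along that word.  Morphisms into [beh_coalg] are therefore determined by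
    the measurings that they induce. *)
Lemma obs_beh_measuring s m : obs beh_measuring s m = beh_ev s m.
Proof.
elim: s m => [|xi s IH] m //; rewrite -[in RHS]cat1s -beh_coprodE /=.
by congr (dual_tens _ _ _); apply: linear_eqP => x /=; [apply: beh_mapE | apply: IH].
Qed.

Theorem beh_universal : universal_measuring beh_measuring.
Proof.
move=> C phi; exists (observe_hom phi); split; first exact: beh_map_observe.
move=> psi psiP; apply: coalg_hom_eq => c; apply: (separating_eq beh_ev_sep) => s.
by rewrite -!obs_beh_measuring (obs_hom _ _ psiP) obs_beh_measuring.
Qed.

End Universal.

(** * Operations on measurings *)

Section Measurings.
Variables (K : fieldType) (O : operad K).
Implicit Types A B E : opalg O.

Section Pullback.
Variables (C D : coalgebra K) (A B : opalg O) (f : coalg_hom C D) (phi : measuring D A B).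

Fact meas_pull_act n (θ : O n.+1) (a : 'I_n.+1 -> A) (c : C) :
  (lincomp phi f c : {linear A -> B}) (alg_act (θ ⊗ₜ puren a))
  = alg_act (θ ⊗ₜ tmapn (fun i => lincomp (hom_eval (a i)) (lincomp phi f))
                    (icoprod C n c)).
Proof.
rewrite [LHS](meas_act phi) icoprod_hom tmapn_comp.
by congr (alg_act (_ ⊗ₜ _)); apply: eq_tmapn.
Qed.

Fact meas_pull_unit (θ : O 0) (c : C) :
  (lincomp phi f c : {linear A -> B}) (alg_u A θ) = (counit C c : K) *: alg_u B θ.
Proof. by rewrite /= meas_unit coalg_map_counit. Qed.

Definition meas_pull : measuring C A B := Measuring meas_pull_act meas_pull_unit.
End Pullback.

(** Both morphisms factor the same measuring, namely the pullback of [Phi]. *)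
Lemma universal_ext A B (M : coalgebra K) (Phi : measuring M A B) C
    (f g : coalg_hom C M) :
  universal_measuring Phi -> (forall c, Phi (f c) = Phi (g c)) -> f = g.
Proof.
move=> uni fg; have [h [_ huniq]] := uni C (meas_pull f Phi).
by rewrite -(huniq f) // -(huniq g) // => c; rewrite -fg.
Qed.

Section Composite.
Variables (C D : coalgebra K) (A B E : opalg O).
Variables (phi : measuring C A B) (chi : measuring D B E).

Fact meas_comp_bilinear :
  is_bilinear (fun c d => lincomp (chi d) (phi c) : homK A E).
Proof. by split=> u a x y; apply: linear_eqP => v; rewrite /= !linearP. Qed.
Definition meas_comp_map : {linear C ⊗ D -> homK A E} := tens_lift meas_comp_bilinear.

Lemma meas_comp_mapE c d : meas_comp_map (c ⊗ₜ d) = lincomp (chi d) (phi c).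
Proof. exact: tens_liftE. Qed.

(** The measuring law of a composite with the iterated coproduct of the first factor
    replaced by an arbitrary tensor, which makes it enough to treat pure tensors. *)
Lemma meas_comp_act_tpow n (θ : O n.+1) (a : 'I_n.+1 -> A) t d :
  (chi d : {linear B -> E})
    (alg_act (θ ⊗ₜ tmapn (fun i => lincomp (hom_eval (a i)) phi) t))
  = alg_act (θ ⊗ₜ tmapn (fun i => lincomp (hom_eval (a i)) meas_comp_map)
                    (tzip n.+1 C D (t ⊗ₜ icoprod D n d))).
Proof.
have lhs_lin : linear (fun t => (chi d : {linear B -> E})
    (alg_act (θ ⊗ₜ tmapn (fun i => lincomp (hom_eval (a i)) phi) t))).
  by move=> k x y; rewrite linearP pureDr pureZr !linearP.
have rhs_lin u : linear (fun t => alg_act (θ ⊗ₜ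
    tmapn (fun i => lincomp (hom_eval (a i)) meas_comp_map)
      (tzip n.+1 C D (t ⊗ₜ u))) : E).
  by move=> k x y; rewrite pureDl pureZl !linearP pureDr pureZr linearP.
move: t; apply: (tpow_ext lhs_lin (rhs_lin _)) => x; rewrite tmapnE meas_act.
move: (icoprod D n d) => u.
have lhs_linu : linear (fun u => alg_act (θ ⊗ₜ
    tmapn (fun i => lincomp (hom_eval ((phi (x i) : {linear A -> B}) (a i))) chi) u) : E).
  by move=> k y z; rewrite linearP pureDr pureZr linearP.
have rhs_linu : linear (fun u => alg_act (θ ⊗ₜ
    tmapn (fun i => lincomp (hom_eval (a i)) meas_comp_map)
      (tzip n.+1 C D (puren x ⊗ₜ u))) : E).
  by move=> k y z; rewrite pureDr pureZr !linearP pureDr pureZr linearP.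
move: u; apply: (tpow_ext lhs_linu rhs_linu) => y; rewrite tzipE !tmapnE.
by congr (alg_act (_ ⊗ₜ puren _)); apply/funext => i /=; rewrite meas_comp_mapE.
Qed.

Let CD := coalg_tens C D.

Fact meas_comp_act n (θ : O n.+1) (a : 'I_n.+1 -> A) (x : CD) :
  (meas_comp_map x : {linear A -> E}) (alg_act (θ ⊗ₜ puren a))
  = alg_act (θ ⊗ₜ tmapn (fun i => lincomp (hom_eval (a i)) meas_comp_map)
                    (icoprod CD n x)).
Proof.
have rhs_lin : linear (fun x => alg_act (θ ⊗ₜ
    tmapn (fun i => lincomp (hom_eval (a i)) meas_comp_map) (icoprod CD n x)) : E).
  by move=> k y z; rewrite !linearP pureDr pureZr linearP.
rewrite -[LHS]/(lincomp (hom_eval (alg_act (θ ⊗ₜ puren a))) meas_comp_map x).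
rewrite -[RHS]/(mklin rhs_lin x); congr (GRing.Linear.sort _ x).
apply: tens_ext => c d.
by rewrite /= icoprod_tens -meas_comp_act_tpow /= meas_comp_mapE /= meas_act.
Qed.

Fact meas_comp_unit (θ : O 0) (x : CD) :
  (meas_comp_map x : {linear A -> E}) (alg_u A θ) = (counit CD x : K) *: alg_u E θ.
Proof.
have rhs_lin : linear (fun x => (counit CD x : K) *: alg_u E θ).
  by move=> k y z; rewrite linearP scalerDl scalerA.
rewrite -[LHS]/(lincomp (hom_eval (alg_u A θ)) meas_comp_map x).
rewrite -[RHS]/(mklin rhs_lin x).
congr (GRing.Linear.sort _ x); apply: tens_ext => c d /=.
by rewrite meas_comp_mapE /= meas_unit linearZ meas_unit tmapE tlunitE /= scalerA.
Qed.

Definition meas_comp : measuring CD A E := Measuring meas_comp_act meas_comp_unit.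
End Composite.

Section HomsAsMeasurings.
Variables A B : opalg O.

Section OfHom.
Variable f : opalg_hom A B.

Fact meas_hom_linear : linear (fun t : coalg_unit K => (t : K) *: (f : homK A B)).
Proof. by move=> a x y; rewrite scalerDl scalerA. Qed.
Let phi := mklin meas_hom_linear.

Fact meas_hom_act n (θ : O n.+1) (a : 'I_n.+1 -> A) (t : coalg_unit K) :
  (phi t : {linear A -> B}) (alg_act (θ ⊗ₜ puren a))
  = alg_act (θ ⊗ₜ tmapn (fun i => lincomp (hom_eval (a i)) phi)
                    (icoprod (coalg_unit K) n t)).
Proof.
rewrite icoprod_unit linearZ tmapnE pureZr linearZ.
apply: (congr1 (fun b : B => (t : K) *: b)); rewrite opalg_map_act.
by congr (alg_act (_ ⊗ₜ puren _)); apply/funext => i /=; rewrite scale1r.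
Qed.

Fact meas_hom_unit (θ : O 0) (t : coalg_unit K) :
  (phi t : {linear A -> B}) (alg_u A θ) = (counit (coalg_unit K) t : K) *: alg_u B θ.
Proof.
congr (_ *: _); rewrite -[alg_u A θ]/(alg_act (θ ⊗ₜ puren (fun=> 0))).
exact: opalg_map_act.
Qed.

Definition meas_hom : measuring (coalg_unit K) A B :=
  Measuring meas_hom_act meas_hom_unit.
End OfHom.

Section ToHom.
Variable phi : measuring (coalg_unit K) A B.

Fact hom_meas_act n (θ : O n) (a : 'I_n -> A) :
  (phi (1 : K^o) : {linear A -> B}) (alg_act (θ ⊗ₜ puren a))
  = alg_act (θ ⊗ₜ puren (fun i => (phi (1 : K^o) : {linear A -> B}) (a i))).
Proof.
case: n θ a => [|n] θ a; last by rewrite meas_act icoprod_unit scale1r tmapnE.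
by rewrite -[LHS]/((phi (1 : K^o) : {linear A -> B}) (alg_u A θ)) meas_unit scale1r.
Qed.

(** The element 1 of [K] is grouplike, so a measuring by [K] takes it to an algebra
    morphism. *)
Definition hom_meas : opalg_hom A B := OpAlgHom hom_meas_act.
End ToHom.
End HomsAsMeasurings.
End Measurings.

(** * The enrichment *)

Section Enrichment.
Variables (K : fieldType) (O : operad K).
Variables (M : opalg O -> opalg O -> coalgebra K)
          (Phi : forall A B : opalg O, measuring (M A B) A B).
Hypothesis uni : forall A B : opalg O, universal_measuring (Phi A B).
Implicit Types A B D E : opalg O.

Definition univ_lift A B C (phi : measuring C A B) : coalg_hom C (M A B) :=
  projT1 (cid (uni phi)).
Lemma univ_liftE A B C (phi : measuring C A B) c : Phi A B (univ_lift phi c) = phi c.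
Proof. by rewrite /univ_lift; case: cid => psi []. Qed.

Definition ecomp A B D : coalg_hom (coalg_tens (M A B) (M B D)) (M A D) :=
  univ_lift (meas_comp (Phi A B) (Phi B D)).
Definition ehom A B (f : opalg_hom A B) : coalg_hom (coalg_unit K) (M A B) :=
  univ_lift (meas_hom f).

Lemma ecompE A B D x y :
  Phi A D (ecomp A B D (x ⊗ₜ y)) = lincomp (Phi B D y) (Phi A B x).
Proof. by rewrite univ_liftE /= meas_comp_mapE. Qed.
Lemma ehomE A B (f : opalg_hom A B) t : Phi A B (ehom f t) = (t : K) *: (f : homK A B).
Proof. exact: univ_liftE. Qed.

Fact ecompA A B D E :
  coalg_comp (coalg_tmap (ecomp A B D) (coalg_id (M D E))) (ecomp A D E)
  = coalg_comp (coalg_comp (coalg_assoc (M A B) (M B D) (M D E))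
      (coalg_tmap (coalg_id (M A B)) (ecomp B D E))) (ecomp A B E).
Proof.
apply: (universal_ext (@uni A E)) => x /=.
tens_induct x as y z; tens_induct y as x y.
by rewrite tassocE !tmapE !ecompE; apply: linear_eqP.
Qed.

Fact ecomp1m A B :
  coalg_comp (coalg_tmap (ehom (opalg_id A)) (coalg_id (M A B))) (ecomp A A B)
  = coalg_lunit (M A B).
Proof.
apply: (universal_ext (@uni A B)) => x /=; tens_induct x as t y.
rewrite tmapE tlunitE ecompE ehomE linearZ.
by apply: linear_eqP => a; rewrite /= linearZ.
Qed.

Fact ecompm1 A B :
  coalg_comp (coalg_tmap (coalg_id (M A B)) (ehom (opalg_id B))) (ecomp A B B)
  = coalg_runit (M A B).
Proof.
apply: (universal_ext (@uni A B)) => x /=; tens_induct x as y t.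
by rewrite tmapE trunitE ecompE ehomE linearZ; apply: linear_eqP.
Qed.

Fact ehom_bij A B : bijective (@ehom A B).
Proof.
exists (fun g => hom_meas (meas_pull g (Phi A B))) => [f|g].
  by apply: opalg_hom_eq => a /=; rewrite ehomE scale1r.
apply: (universal_ext (@uni A B)) => t; rewrite ehomE.
by rewrite -[RHS]/(lincomp (Phi A B) g t) -[t in RHS]mulr1 linearZ.
Qed.

Fact ehomM A B D (f : opalg_hom A B) (g : opalg_hom B D) :
  ehom (opalg_comp f g)
  = coalg_comp (coalg_comp (coalg_lunitV (coalg_unit K))
      (coalg_tmap (ehom f) (ehom g))) (ecomp A B D).
Proof.
apply: (universal_ext (@uni A D)) => t; rewrite ehomE /= tmapE ecompE !ehomE.
by apply: linear_eqP => a /=; rewrite scale1r.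
Qed.

Definition meas_enrichment : @enrichment (coalg_monoidal K) (opalg_cat O) M :=
  @Enrichment (coalg_monoidal K) (opalg_cat O) M ecomp (fun A => ehom (opalg_id A))
    ecompA ecomp1m ecompm1 ehom ehom_bij (fun=> erefl) ehomM.

End Enrichment.

Theorem theorem1p3 (K : fieldType) (O : operad K) :
  (forall A B : opalg O,
     exists (M : coalgebra K) (Phi : measuring M A B), universal_measuring Phi)
  /\
  (forall (M : opalg O -> opalg O -> coalgebra K)
          (Phi : forall A B : opalg O, measuring (M A B) A B),
     (forall A B : opalg O, universal_measuring (Phi A B)) ->
     exists E : @enrichment (coalg_monoidal K) (opalg_cat O) M,
       (forall (A B D : opalg O) (x : M A B) (y : M B D),
          Phi A D ((enr_comp E A B D : coalg_hom _ _) (x ⊗ₜ y))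
          = lincomp (Phi B D y) (Phi A B x))
       /\
       (forall (A : opalg O) (t : K),
          Phi A A ((enr_unit E A : coalg_hom _ _) t) = t *: (linid A : homK A A))).
Proof.
split=> [A B|M Phi uni].
  by exists (beh_coalg A B), (beh_measuring A B); apply: beh_universal.
exists (meas_enrichment uni); split=> [A B D x y|A t]; first exact: ecompE.
exact: ehomE.
Qed.
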